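(* Let $q\ge2$, let $a,b>0$ be fixed, and set $d=\frac{a+(q-1)b}{q}$ and $\lambda=\frac{a-b}{a+(q-1)b}$. If there is nonreconstruction (almost surely) on the Poisson($d$) Galton–Watson tree for the $q$-state symmetric broadcast process with second eigenvalue $\lambda$, then detection is information-theoretically impossible on the stochastic block model $\mathcal{G}(n,q,\frac an,\frac bn)$.
   Context: Broadcast process: given a tree $T$ with root $\rho$ and $\lambda\in[-\frac1{q-1},1)$, the spin $\sigma_\rho$ is uniform on $\{1,\dots,q\}$, and if $v$ is the parent of $u$, then $\mathbb{P}(\sigma_u=j\mid\sigma_v=i)=\lambda+\frac{1-\lambda}q$ if $i=j$ and $\frac{1-\lambda}q$ otherwise (propagated along edges away from the root). $\sigma(n)$ denotes the spins at distance $n$ from the root and $\sigma^i(n)$ denotes $\sigma(n)$ conditioned on $\sigma_\rho=i$. There is nonreconstruction for $T$ at $\lambda$ if $\limsup_{n\to\infty}d_{\rm TV}(\sigma^i(n),\sigma^j(n))=0$ for all $i,j$. The Poisson($d$) Galton–Watson tree is the Galton–Watson tree with Poisson offspring distribution of mean $d$. Stochastic block model: $\mathcal{G}(n,q,p_{\rm in},p_{\rm out})$ is the random graph on $\{1,\dots,n\}$ in which each vertex $u$ is independently assigned a label $\sigma_u\in\{1,\dots,q\}$ uniformly at random, and each possible edge $(u,v)$ is included independently with probability $p_{\rm in}$ if $\sigma_u=\sigma_v$ and $p_{\rm out}$ otherwise. Detection is possible for $\mathcal{G}(n,q,\frac an,\frac bn)$ if there exist $\epsilon>0$ and an estimator $\hat\sigma(G)$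 taking the graph $G\sim\mathcal{G}(n,q,\frac an,\frac bn)$ as input and returning $\hat\sigma:\{1,\dots,n\}\to\{1,\dots,q\}$ such that $\limsup_{n\to\infty}\frac1n\mathbb{E}\big[\max_{\Gamma\in S_q}|\{u:\hat\sigma_u=\Gamma(\sigma_u)\}|\big]\ge\frac1q+\epsilon$, where $S_q$ is the group of permutations of $\{1,\dots,q\}$; otherwise detection is (information-theoretically) impossible. There is no computational restriction on $\hat\sigma$. *)

(* Defs.v *)
From mathcomp Require Import all_boot all_order all_fingroup all_algebra.
From mathcomp Require Import all_classical all_reals all_analysis.

Set Implicit Arguments.
Unset Strict Implicit.
Unset Printing Implicit Defensive.

Import Order.TTheory GRing.Theory Num.Theory.

Local Open Scope classical_set_scope.
Local Open Scope ring_scope.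

(* A locally finite rooted tree is given by its offspring numbers in
   Ulam-Harris notation: a vertex is the sequence of child indices on the path
   from the root [::], and the children of u are rcons u k for k < c u (the
   value of c at a sequence that is not a vertex is irrelevant). *)
Definition tree := seq nat -> nat.

Definition children (c : tree) (u : seq nat) : seq (seq nat) :=
  [seq rcons u k | k <- iota 0 (c u)].

Fixpoint level (c : tree) (n : nat) : seq (seq nat) :=
  if n is m.+1 then flatten [seq children c u | u <- level c m]
  else [:: [::]].

Definition ball (c : tree) (n : nat) : seq (seq nat) :=
  flatten [seq level c m | m <- iota 0 n.+1].

Definition ball_spins (c : tree) (n q : nat) :=
  {ffun seq_sub (ball c n) -> 'I_q}.

Definition level_spins (c : tree) (n q : nat) :=
  {ffun seq_sub (level c n) -> 'I_q}.

Definition transition (R : realType) (q : nat) (lam : R) (i j : 'I_q) : R :=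
  if i == j then lam + (1 - lam) / q%:R else (1 - lam) / q%:R.

(* Joint law of the broadcast process on the vertices at distance at most n
   from the root; the product ranges over the (parent, child) pairs. *)
Definition broadcast_pmf (R : realType) (c : tree) (n q : nat) (lam : R)
    (s : ball_spins c n q) : R :=
  q%:R^-1 *
  \prod_(e : seq_sub (ball c n) * seq_sub (ball c n)
           | val e.2 \in children c (val e.1))
    transition lam (s e.1) (s e.2).

Definition broadcast_prob (R : realType) (c : tree) (n q : nat) (lam : R)
    (E : pred (ball_spins c n q)) : R :=
  \sum_(s : ball_spins c n q | E s) broadcast_pmf lam s.

Definition root_is (c : tree) (n q : nat) (i : 'I_q)
    (s : ball_spins c n q) : bool :=
  [forall u, (val u == [::]) ==> (s u == i)].

Definition level_is (c : tree) (n q : nat) (t : level_spins c n q)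
    (s : ball_spins c n q) : bool :=
  [forall u, forall v, (val u == val v) ==> (s u == t v)].

(* The law of the spins at distance n, conditioned on the root spin being i. *)
Definition level_law (R : realType) (c : tree) (n q : nat) (lam : R) (i : 'I_q)
    (t : level_spins c n q) : R :=
  broadcast_prob lam (fun s => root_is i s && level_is t s) /
  broadcast_prob lam (@root_is c n q i).

Definition dTV (R : realType) (X : finType) (mu nu : X -> R) : R :=
  2^-1 * \sum_(x : X) `|mu x - nu x|.

Definition nonreconstruction (R : realType) (q : nat) (lam : R) (c : tree) :
    Prop :=
  forall i j : 'I_q,
    limn_esup (fun n : nat =>
      (dTV (@level_law R c n q lam i) (@level_law R c n q lam j))%:E) = 0%E.

Definition mutually_independent (R : realType) (disp disp' : measure_display)
    (Omega : measurableType disp) (T : measurableType disp')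
    (P : probability Omega R) (I : eqType) (X : I -> {RV P >-> T}) : Prop :=
  forall (J : seq I) (A : I -> set T),
    uniq J -> (forall i, measurable (A i)) ->
    P (\bigcap_(i in [set` J]) (X i @^-1` A i)) =
    (\prod_(i <- J) P (X i @^-1` A i))%E.

(* For every outcome w, fun u => xi u w is the realization of the tree. *)
Definition poisson_galton_watson (R : realType) (disp : measure_display)
    (Omega : measurableType disp) (P : probability Omega R) (d : R)
    (xi : seq nat -> {RV P >-> nat}) : Prop :=
  mutually_independent xi /\
  forall (u : seq nat) (k : nat),
    P (xi u @^-1` [set k]) = (poisson_pmf d k)%:E.

Definition simple_graph (n : nat) :=
  {E : {set 'I_n * 'I_n} |
    [forall u, (u, u) \notin E] &&
    [forall u, forall v, ((u, v) \in E) == ((v, u) \in E)]}.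

Definition labelling (n q : nat) := {ffun 'I_n -> 'I_q}.

Definition edge_prob (R : realType) (n q : nat) (pin pout : R)
    (s : labelling n q) (u v : 'I_n) : R :=
  if s u == s v then pin else pout.

(* Joint law of the labels and of the graph in the stochastic block model. *)
Definition sbm_pmf (R : realType) (n q : nat) (pin pout : R)
    (s : labelling n q) (G : simple_graph n) : R :=
  (q%:R ^+ n)^-1 *
  \prod_(e : 'I_n * 'I_n | (e.1 < e.2)%N)
    (if e \in val G then edge_prob pin pout s e.1 e.2
     else 1 - edge_prob pin pout s e.1 e.2).

Definition sbm_expectation (R : realType) (n q : nat) (pin pout : R)
    (f : labelling n q -> simple_graph n -> R) : R :=
  \sum_(s : labelling n q) \sum_(G : simple_graph n) sbm_pmf pin pout s G * f s G.

Definition agreement (n q : nat) (shat s : labelling n q) : nat :=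
  (\max_(g : 'S_q) #|[set u : 'I_n | shat u == g (s u)]%SET|)%N.

(* For the finitely many n < max(a, b) the numbers a/n, b/n need not be
   probabilities; this does not affect the limsup. *)
Definition detection_possible (R : realType) (q : nat) (a b : R) : Prop :=
  exists (eps : R) (est : forall n : nat, simple_graph n -> labelling n q),
    0 < eps /\
    ((q%:R^-1 + eps)%:E <=
     limn_esup (fun n : nat =>
       (n%:R^-1 *
        sbm_expectation (a / n%:R) (b / n%:R)
          (fun s G => (agreement (est n G) s)%:R : R))%:E))%E.

(* Main.v *)
Require Import Defs.
From mathcomp Require Import all_boot all_order all_fingroup all_algebra.
From mathcomp Require Import all_classical all_reals all_analysis.
From mathcomp Require Import ring lra zify.

Set Implicit Arguments.
Unset Strict Implicit.
Unset Printing Implicit Defensive.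

Import Order.TTheory GRing.Theory Num.Theory.
Import numFieldNormedType.Exports.

Local Open Scope classical_set_scope.
Local Open Scope ring_scope.

(** Why detection fails.  Fix two vertices u and v.  A typical graph reveals the
    label of u only through its neighbourhood, which looks like a
    Poisson(d) Galton-Watson tree carrying a broadcast process.  Even somebody who
    is shown the graph and the label of v, and in addition all labels at depth r
    around u, learns about the label of u no more than the broadcast spins of
    generation r do, and by nonreconstruction this is almost nothing once r is
    large.  Hence, given the graph, the labels of u and v are nearly
    uncorrelated, and a second moment computation shows that every estimator
    agrees with the labels on a fraction of vertices close to 1/q.

    No coupling with the tree is built.  Information is measured by
    [graph_norm]: the L1 norm of the signed law of the graph that a signed density
    on labellings induces.  For a difference of two densities it is twice the
    total variation distance between the two graph laws.  It is computed by
    exposing vertices one by one, and one exposure is controlled by [peel_ineq]: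
    the root has a binomial number of neighbours among the fresh vertices, their
    labels are drawn from the broadcast kernel, edges to vertices that are
    already known are unlikely, and the missing edges to the fresh vertices are
    almost uninformative.  The last point is a variance bound, [deviation_le]:
    the expected number of neighbours does not depend on the label of the root,
    so the product over the missing edges concentrates around the same value for
    all labels.

    Letting the number of vertices grow for a fixed number of exposures turns
    this into a clean inequality, [asym_le_peel], with Poisson weights and no
    error term except for the roots with more than K children.  Iterating it
    generation by generation, [asym_wit_shapes] bounds the information in the graph by an average, over the offspring numbers of the
    first r generations, of the information in the spins of generation r; these
    offspring numbers have the law of the Galton-Watson tree by [prob_shape], and
    the information is the total variation distance of the broadcast laws by
    [dTV_level_law].  Nonreconstruction makes the average small,
    [shapes_bound]. *)

(** * Sums over lists of a fixed length *)

Lemma sum_tuple_cons (V : nmodType) (A : finType) {m} (F : seq A -> V) :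
  \sum_(s : m.+1.-tuple A) F s =
  \sum_(x : A) \sum_(s : m.-tuple A) F (x :: s).
Proof.
rewrite pair_big /=.
rewrite (reindex (fun e : A * m.-tuple A => cons_tuple e.1 e.2)) //=.
exists (fun s : m.+1.-tuple A => (thead s, behead_tuple s)).
  by move=> [x s] _ /=; congr (_, _); apply: val_inj.
by move=> s _; rewrite [RHS]tuple_eta; apply: val_inj.
Qed.

Lemma sum_tuple0 (V : nmodType) (A : finType) (F : seq A -> V) :
  \sum_(s : 0.-tuple A) F s = F [::].
Proof.
rewrite (bigD1 [tuple]) //= big1 ?addr0 // => s.
by rewrite tuple0.
Qed.

Lemma sum_tuple_cat (V : nmodType) (A : finType) {m k} (F : seq A -> V) :
  \sum_(s : (m + k).-tuple A) F s =
  \sum_(s : m.-tuple A) \sum_(t : k.-tuple A) F (s ++ t).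
Proof.
elim: m F => [|m IH] F.
  by rewrite (@sum_tuple0 _ _ (fun s => \sum_(t : k.-tuple A) F (s ++ t))).
rewrite (@sum_tuple_cons _ _ (m + k)).
rewrite (@sum_tuple_cons _ _ m (fun s => \sum_(t : k.-tuple A) F (s ++ t))).
by apply: eq_bigr => x _; rewrite (IH (fun s => F (x :: s))).
Qed.

Fixpoint swap_at (T : Type) (k : nat) (s : seq T) {struct k} : seq T :=
  match k, s with
  | O, x :: y :: s' => y :: x :: s'
  | k'.+1, x :: s' => x :: @swap_at T k' s'
  | _, _ => s
  end.

(** Permutations of positions are encoded as lists of adjacent transpositions.
    The same list acts on label lists and on rows of edges, and invariance under
    permutations only has to be checked for two neighbouring positions. *)
Definition swaps (T : Type) (ks : seq nat) (s : seq T) : seq T :=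
  foldr (@swap_at T) s ks.

Lemma size_swap_at (T : Type) k (s : seq T) : size (swap_at k s) = size s.
Proof. by elim: k s => [|k IH] [|x [|y s]] //=; rewrite IH. Qed.

Lemma size_swaps (T : Type) ks (s : seq T) : size (swaps ks s) = size s.
Proof. by elim: ks => //= k ks IH; rewrite size_swap_at. Qed.

Lemma sum_tuple_swap_at (V : nmodType) (A : finType) {m} k (F : seq A -> V) :
  \sum_(s : m.-tuple A) F (swap_at k s) = \sum_(s : m.-tuple A) F s.
Proof.
elim: k m F => [|k IH] [|m] F.
- by rewrite (sum_tuple0 (fun s => F (swap_at 0 s))) sum_tuple0.
- case: m => [|m].
    by apply: eq_bigr => s _; case/tupleP: s => x s; rewrite tuple0.
  rewrite (sum_tuple_cons (fun s => F (swap_at 0 s))) sum_tuple_cons.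
  under eq_bigr => x _ do rewrite (sum_tuple_cons (fun s => F (swap_at 0 (x :: s)))).
  rewrite exchange_big; apply: eq_bigr => x _.
  by rewrite (sum_tuple_cons (fun s => F (x :: s))).
- by rewrite (sum_tuple0 (fun s => F (swap_at k.+1 s))) sum_tuple0.
- rewrite (sum_tuple_cons (fun s => F (swap_at k.+1 s))) sum_tuple_cons.
  by apply: eq_bigr => x _; rewrite -(IH _ (fun s => F (x :: s))).
Qed.

Lemma sum_tuple_swaps (V : nmodType) (A : finType) {m} ks (F : seq A -> V) :
  \sum_(s : m.-tuple A) F (swaps ks s) = \sum_(s : m.-tuple A) F s.
Proof.
elim: ks F => [//|k ks IH] F /=.
by rewrite (IH (fun s => F (swap_at k s))) sum_tuple_swap_at.
Qed.

Lemma swaps_map_succ (T : Type) ks (x : T) s :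
  swaps (map S ks) (x :: s) = x :: swaps ks s.
Proof. by elim: ks => //= k ks ->. Qed.

Lemma swaps_cat (T : Type) ks ks' (s : seq T) :
  swaps (ks ++ ks') s = swaps ks (swaps ks' s).
Proof. exact: foldr_cat. Qed.

Lemma move_swaps n : exists ks : seq nat, forall (T : Type) (x : T) u v,
  size u = n -> swaps ks (x :: u ++ v) = u ++ x :: v.
Proof.
elim: n => [|n [ks Hks]]; first by exists [::] => T x [|//] v.
exists (map S ks ++ [:: 0%N]) => T x [//|y u] v [szu].
by rewrite swaps_cat /= swaps_map_succ Hks.
Qed.

(** One list of transpositions serves all entry types: it is applied to the
    labels of some vertices and, simultaneously, to the row of edges that join
    them to the root. *)
Lemma partition_swaps (b : bitseq) :
  exists ks : seq nat, forall (T : Type) (s : seq T), size s = size b ->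
    swaps ks s = mask b s ++ mask (map negb b) s.
Proof.
elim: b => [|[] b [ks Hks]].
- by exists [::] => T [].
- exists (map S ks) => T [//|x s] /= [sz].
  by rewrite swaps_map_succ Hks.
- have [ks' Hks'] := move_swaps (count id b).
  exists (ks' ++ map S ks) => T [//|x s] /= [sz].
  by rewrite swaps_cat swaps_map_succ Hks // Hks' // size_mask.
Qed.

Lemma front_swaps k : exists ks : seq nat, forall (T : Type) (x0 : T) s,
  (k < size s)%N -> swaps ks s = nth x0 s k :: take k s ++ drop k.+1 s.
Proof.
elim: k => [|k [ks Hks]].
  by exists [::] => T x0 [//|x s] _ /=; rewrite drop0.
exists (0%N :: map S ks) => T x0 [//|x s] ks' /=.
by rewrite swaps_map_succ (Hks _ x0).
Qed.

(** Brings two chosen vertices to the two positions from which the exploration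
    starts. *)
Lemma front2_swaps n (u v : nat) : u != v -> (u < n)%N -> (v < n)%N ->
  exists ks : seq nat, forall (T : Type) (x0 : T) s, size s = n ->
  take 2 (swaps ks s) = [:: nth x0 s v; nth x0 s u].
Proof.
move=> uv un vn; have [ks Hks] := front_swaps v.
have [ks' Hks'] := front_swaps (if (u < v)%N then u else u.-1).
exists (map S ks' ++ ks) => T x0 s sn.
rewrite swaps_cat (Hks _ x0) ?sn // swaps_map_succ.
have szt : size (take v s) = v by rewrite size_takel // sn ltnW.
rewrite (Hks' _ x0); last by rewrite size_cat szt size_drop sn; case: ifP; lia.
rewrite /= take0 nth_cat szt; congr [:: _; _].
have [uv'|uv'] := ltnP u v; first by rewrite uv' nth_take.
have vu : (v < u)%N by rewrite ltn_neqAle eq_sym uv.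
have -> : (u.-1 < v)%N = false by lia.
by rewrite nth_drop; congr nth; lia.
Qed.

(** * Exposing a random graph vertex by vertex *)

Definition edge_weight (R : realFieldType) (A : finType) (p : A -> A -> R)
    (l x : A) (e : bool) : R :=
  if e then p l x else 1 - p l x.

Definition row_weight (R : realFieldType) (A : finType) (p : A -> A -> R)
    (l : A) (b : bitseq) (s : seq A) : R :=
  \prod_(e <- zip b s) edge_weight p l e.2 e.1.

(** The signed density of the labels of the remaining vertices once the row of
    edges at the first vertex is observed and its label is summed out. *)
Definition peel_root (R : realFieldType) (A : finType) (p : A -> A -> R)
    (F : seq A -> R) (b : bitseq) (s : seq A) : R :=
  \sum_(l : A) F (l :: s) * row_weight p l b s.

(** This is the sum over all graphs G on m vertices of the absolute value of
    the sum over label lists s of F(s) times the probability of G given s.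
    Unfolded vertex by vertex, it never mentions graphs, and each step isolates
    the observation of one row of edges. *)
Fixpoint graph_norm (R : realFieldType) (A : finType) (p : A -> A -> R)
    (m : nat) (F : seq A -> R) {struct m} : R :=
  if m is m'.+1 then
    \sum_(b : m'.-tuple bool) graph_norm p m' (peel_root p F b)
  else `|F [::]|.

Section GraphNorm.
Context (R : realFieldType) (A : finType) (p : A -> A -> R).
Implicit Types (F G : seq A -> R) (b : bitseq) (s : seq A).

Lemma row_weight_cons l e b x s :
  row_weight p l (e :: b) (x :: s) = edge_weight p l x e * row_weight p l b s.
Proof. by rewrite /row_weight /= big_cons. Qed.

Lemma row_weight_nil l b : row_weight p l b [::] = 1.
Proof. by case: b => [|e b]; rewrite /row_weight big_nil. Qed.

Lemma row_weight_cat l b b' s s' : size b = size s ->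
  row_weight p l (b ++ b') (s ++ s') = row_weight p l b s * row_weight p l b' s'.
Proof. by move=> e; rewrite /row_weight zip_cat // big_cat. Qed.

Lemma zip_swap_at (T U : Type) k (s : seq T) (t : seq U) : size s = size t ->
  zip (swap_at k s) (swap_at k t) = swap_at k (zip s t).
Proof.
elim: k s t => [|k IH] [|x s] [|y t] //=; last by move=> [e]; rewrite IH.
by case: s t => [|x' s] [|y' t].
Qed.

Lemma prod_swap_at (T : Type) k (s : seq T) (f : T -> R) :
  \prod_(x <- swap_at k s) f x = \prod_(x <- s) f x.
Proof.
elim: k s => [|k IH] [|x s] //=.
  by case: s => [|y s] //; rewrite !big_cons mulrCA.
by rewrite !big_cons IH.
Qed.

Lemma row_weight_swap_at l k b s : size b = size s ->
  row_weight p l (swap_at k b) (swap_at k s) = row_weight p l b s.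
Proof. by move=> e; rewrite /row_weight zip_swap_at // prod_swap_at. Qed.

Lemma eq_graph_norm m F G :
  (forall s, size s = m -> F s = G s) -> graph_norm p m F = graph_norm p m G.
Proof.
elim: m F G => [|m IH] F G e /=; first by rewrite e.
apply: eq_bigr => b _; apply: IH => s sz.
by apply: eq_bigr => l _; rewrite e //= sz.
Qed.

Lemma graph_norm_ge0 m F : 0 <= graph_norm p m F.
Proof. by elim: m F => [|m IH] F //=; apply: sumr_ge0. Qed.

Lemma graph_normD m F G :
  graph_norm p m (fun s => F s + G s) <= graph_norm p m F + graph_norm p m G.
Proof.
elim: m F G => [|m IH] F G /=; first exact: ler_normD.
rewrite -big_split; apply: ler_sum => b _; apply: le_trans (IH _ _).
rewrite le_eqVlt; apply/orP; left; apply/eqP/eq_graph_norm => s _.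
by rewrite /peel_root -big_split; apply: eq_bigr => l _; rewrite mulrDl.
Qed.

Lemma graph_normZ m a F :
  graph_norm p m (fun s => a * F s) = `|a| * graph_norm p m F.
Proof.
elim: m F => [|m IH] F /=; first exact: normrM.
rewrite big_distrr /=; apply: eq_bigr => b _; rewrite -IH.
apply: eq_graph_norm => s _.
by rewrite /peel_root big_distrr; apply: eq_bigr => l _; rewrite /= mulrA.
Qed.

Hypothesis p01 : forall l x, 0 <= p l x <= 1.

Lemma edge_weight_ge0 l x e : 0 <= edge_weight p l x e.
Proof. by have /andP[] := p01 l x; case: e; rewrite //= subr_ge0. Qed.

Lemma row_weight_ge0 l b s : 0 <= row_weight p l b s.
Proof. by apply: prodr_ge0 => e _; apply: edge_weight_ge0. Qed.

Lemma sum_row_weight l m s : size s = m ->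
  \sum_(b : m.-tuple bool) row_weight p l b s = 1.
Proof.
elim: m s => [|m IH] [|x s] //=.
  by rewrite (sum_tuple0 (fun b => row_weight p l b [::])) row_weight_nil.
move=> [sz]; rewrite (sum_tuple_cons (fun b => row_weight p l b (x :: s))).
under eq_bigr => e _.
  under eq_bigr => b _ do rewrite row_weight_cons.
  rewrite -big_distrr /= IH // mulr1.
  over.
by rewrite big_bool /=; ring.
Qed.

(** Passing from labels to graphs is a Markov kernel, hence a contraction. *)
Lemma graph_norm_le_l1 m F :
  graph_norm p m F <= \sum_(s : m.-tuple A) `|F s|.
Proof.
elim: m F => [|m IH] F /=; first by rewrite (sum_tuple0 (fun s => `|F s|)).
apply: (@le_trans _ _ (\sum_(b : m.-tuple bool) \sum_(s : m.-tuple A)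
    \sum_l `|F (l :: s)| * row_weight p l b s)).
  apply: ler_sum => b _; apply: le_trans (IH _) _; apply: ler_sum => s _.
  apply: le_trans (ler_norm_sum _ _ _) _; apply: ler_sum => l _.
  by rewrite normrM (ger0_norm (row_weight_ge0 _ _ _)).
rewrite (sum_tuple_cons (fun s => `|F s|)) [leLHS]exchange_big [leRHS]exchange_big /=.
apply: ler_sum => s _; rewrite exchange_big; apply: ler_sum => l _.
by rewrite -big_distrr sum_row_weight ?size_tuple //= mulr1.
Qed.

Lemma graph_norm_close m F G :
  graph_norm p m F <= graph_norm p m G + \sum_(s : m.-tuple A) `|F s - G s|.
Proof.
rewrite -(@eq_graph_norm _ (fun s => G s + (F s - G s)) F); last first.
  by move=> s _; ring.
by apply: le_trans (graph_normD _ _ _) _; rewrite lerD2l graph_norm_le_l1.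
Qed.

Hypothesis psym : forall l x, p l x = p x l.

(** Relabelling the vertices of a graph is a bijection, so the observation
    does not depend on the order in which the vertices are exposed.  Exchanging
    the first two vertices moves the edge between them from one row to the
    other; this is where the symmetry of [p] enters. *)
Lemma graph_norm_swap_at m k F :
  graph_norm p m (fun s => F (swap_at k s)) = graph_norm p m F.
Proof.
elim: k m F => [|k IH] [|m] F //.
  case: m => [|m].
    by apply: eq_graph_norm => -[//|x [|]].
  rewrite /graph_norm -/graph_norm.
  rewrite (sum_tuple_cons (fun b => \sum_b' graph_norm p m (peel_root p
    (peel_root p (fun s => F (swap_at 0 s)) b) (tval b')))).
  rewrite (sum_tuple_cons (fun b => \sum_b' graph_norm p m (peel_root p
    (peel_root p F b) (tval b')))).
  apply: eq_bigr => e _.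
  rewrite exchange_big; apply: eq_bigr => b _; apply: eq_bigr => b' _.
  apply: eq_graph_norm => s _; rewrite /peel_root /=.
  under eq_bigr => l _ do rewrite big_distrl /=.
  rewrite exchange_big; apply: eq_bigr => l _; rewrite big_distrl /=.
  apply: eq_bigr => l' _; rewrite !row_weight_cons.
  by rewrite /edge_weight (psym l l'); ring.
rewrite /graph_norm -/graph_norm.
rewrite -(sum_tuple_swap_at k (fun b => graph_norm p m (peel_root p F b))).
apply: eq_bigr => b _.
rewrite -(IH _ (peel_root p F (swap_at k b))).
apply: eq_graph_norm => s sz; apply: eq_bigr => l _ /=.
by rewrite row_weight_swap_at // size_tuple.
Qed.

Lemma graph_norm_swaps m ks F :
  graph_norm p m (fun s => F (swaps ks s)) = graph_norm p m F.
Proof.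
elim: ks F => [//|k ks IH] F /=.
by rewrite (IH (fun s => F (swap_at k s))) graph_norm_swap_at.
Qed.

End GraphNorm.

(** * Exposing one vertex of a sparse graph *)

Lemma sum_tuple_prod (R : comNzRingType) (A : finType) n (f : A -> R) :
  \sum_(s : n.-tuple A) \prod_(x <- s) f x = (\sum_x f x) ^+ n.
Proof.
elim: n => [|n IH].
  by rewrite (sum_tuple0 (fun s => \prod_(x <- s) f x)) big_nil.
rewrite (sum_tuple_cons (fun s => \prod_(x <- s) f x)) exprS -IH big_distrl.
apply: eq_bigr => x _; rewrite big_distrr.
by apply: eq_bigr => s _; rewrite big_cons.
Qed.

Lemma sum_tuple_count N t :
  (\sum_(b : N.-tuple bool) (count id b == t) = 'C(N, t))%N.
Proof.
elim: N t => [|N IH] t.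
  by rewrite (sum_tuple0 (fun b => (count id b == t) : nat)) /= eq_sym; case: t.
rewrite (sum_tuple_cons (fun b => (count id b == t) : nat)) big_bool /=.
change ((\sum_(s : N.-tuple bool) ((count id s).+1 == t) +
  \sum_(s : N.-tuple bool) (count id s == t))%N = 'C(N.+1, t)).
rewrite IH; case: t => [|t]; last by rewrite binS addnC IH.
by rewrite big1 // !bin0.
Qed.

Lemma sum_count_le (R : realFieldType) N K (f : nat -> R) :
  \sum_(b : N.-tuple bool | (count id b <= K)%N) f (count id b) =
  \sum_(t < K.+1) 'C(N, t)%:R * f t.
Proof.
rewrite big_mkcond /=.
transitivity (\sum_(b : N.-tuple bool) \sum_(t < K.+1)
   (count id b == t)%:R * f t).
  apply: eq_bigr => b _; case: ifP => h.
    rewrite (bigD1 (Ordinal (h : (count id b < K.+1)%N))) //= eqxx mul1r.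
    rewrite big1 ?addr0 // => i /eqP ni.
    case: eqP => [e|]; last by rewrite mul0r.
    by case: ni; apply: val_inj; rewrite /= e.
  rewrite big1 // => i _; case: eqP => [e|]; last by rewrite mul0r.
  by move: h; rewrite e -ltnS ltn_ord.
rewrite exchange_big; apply: eq_bigr => t _.
by rewrite -big_distrl /= -sum_tuple_count natr_sum.
Qed.

Lemma sum_tuple_const (R : comNzRingType) (A : finType) n (x : R) :
  \sum_(s : n.-tuple A) x = #|A|%:R ^+ n * x.
Proof. by rewrite sumr_const card_tuple -[LHS]mulr_natl natrX. Qed.

Lemma prod_scale (R : comNzRingType) (A : eqType) (u : R) (f : A -> R) s :
  \prod_(x <- s) (u * f x) = u ^+ size s * \prod_(x <- s) f x.
Proof.
elim: s => [|x s IH]; first by rewrite !big_nil mulr1.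
by rewrite !big_cons IH exprS mulrACA.
Qed.

Section ProductBounds.
Context (R : realFieldType) (A : eqType).

Lemma prod_one_minus (f : A -> R) beta (s : seq A) :
  (forall x, 0 <= f x <= 1) -> (forall x, f x <= beta) ->
  1 - (size s)%:R * beta <= \prod_(x <- s) (1 - f x) <= 1.
Proof.
move=> f01 fb; elim: s => [|x s /andP[IH1 IH2]].
  by rewrite big_nil mul0r subr0 lexx.
rewrite big_cons /= -natr1; have /andP[f0 f1] := f01 x; have fx := fb x.
have P0 : 0 <= \prod_(y <- s) (1 - f y).
  by apply: prodr_ge0 => y _; have /andP[] := f01 y; lra.
by move: (\prod_(y <- s) _) IH1 IH2 P0 => P IH1 IH2 P0; apply/andP; split; nra.
Qed.

End ProductBounds.

Lemma expr_sub_le (R : realFieldType) (x y : R) n :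
  0 <= y -> y <= x -> x <= 1 -> x ^+ n - y ^+ n <= n%:R * (x - y).
Proof.
move=> y0 yx x1; elim: n => [|n IH]; first by rewrite !expr0 mul0r subrr.
have xn1 : x ^+ n <= 1 by apply: exprn_ile1 => //; lra.
have yn0 : 0 <= y ^+ n by apply: exprn_ge0.
have yn : y ^+ n <= x ^+ n by apply: lerXn2r => //; rewrite nnegrE; lra.
rewrite !exprS -natr1; move: (x ^+ n) (y ^+ n) (n%:R) IH xn1 yn0 yn => X Y m; nra.
Qed.

(** Replaces the Cauchy-Schwarz inequality: first moments are bounded by second
    moments without square roots, at the price of a free parameter. *)
Lemma norm_le_sqr (R : realFieldType) (w y : R) : 0 < w -> `|y| <= w + y ^+ 2 / w.
Proof.
move=> w0; rewrite -real_normK ?num_real //.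
move: (`|y|) (normr_ge0 y) => z z0; have [zw|zw] := leP z w.
  by apply: le_trans zw _; rewrite lerDl divr_ge0 ?sqr_ge0 // ltW.
rewrite -[z in leLHS](mulfK (lt0r_neq0 w0)) -[leLHS]add0r lerD ?(ltW w0) //.
by rewrite ler_pM2r ?invr_gt0 // expr2 ler_wpM2l // ltW.
Qed.

Definition l1norm (R : realFieldType) (A : finType) k (c : seq A -> R) : R :=
  \sum_(s : k.-tuple A) `|c s|.

(** The density of [k] distinguished vertices with signed density [c], followed
    by [N] fresh vertices whose labels are independent and uniform. *)
Definition padded (R : realFieldType) (A : finType) k N (c : seq A -> R)
    (s : seq A) : R :=
  c (take k s) * #|A|%:R^-1 ^+ N.

(** The first vertex, of label [l], is forgotten; its children, with labels drawn
    from [M l], join the list behind the [k] other distinguished vertices. *)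
Definition branch (R : realFieldType) (A : finType) (M : A -> A -> R) k
    (c : seq A -> R) (s : seq A) : R :=
  \sum_(l : A) c (l :: take k s) * \prod_(x <- drop k s) M l x.

(** The row of a root that has no edge to the [k] distinguished vertices and
    whose neighbours are the first [t] fresh ones. *)
Definition sorted_row k t n : bitseq :=
  nseq k false ++ nseq t true ++ nseq n false.

(** The edge probabilities for which a fresh vertex is a neighbour of a root of
    label [l] with probability [zeta], for all [l], and then has a label of law
    [M l]. *)
Definition kernel_edge (R : realFieldType) (A : finType) (M : A -> A -> R)
    (zeta : R) (l x : A) : R :=
  zeta * #|A|%:R * M l x.

Section Peel.
Context (R : realFieldType) (A : finType) (M : A -> A -> R) (zeta beta : R).
Hypothesis A_gt0 : (0 < #|A|)%N.
Hypothesis M_ge0 : forall l x, 0 <= M l x.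
Hypothesis M_sum : forall l, \sum_x M l x = 1.
Hypothesis M_sym : forall l x, M l x = M x l.
Hypothesis zeta_ge0 : 0 <= zeta.
Hypothesis zeta_beta : forall l x, kernel_edge M zeta l x <= beta.
Hypothesis beta_le1 : beta <= 1.
Local Notation p := (kernel_edge M zeta).
Local Notation U := (#|A|%:R^-1).

Let p01 l x : 0 <= p l x <= 1.
Proof.
by rewrite /kernel_edge !mulr_ge0 ?ler0n //= (le_trans (zeta_beta _ _)).
Qed.

Let psym l x : p l x = p x l.
Proof. by rewrite /kernel_edge M_sym. Qed.

Let Uq : U * #|A|%:R = 1 :> R.
Proof. by rewrite mulVf // pnatr_eq0 -lt0n. Qed.

Let U_ge0 : 0 <= U :> R.
Proof. by rewrite invr_ge0. Qed.

Let mean_const (x : R) : \sum_(y : A) U * x = x.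
Proof. by rewrite sumr_const -[LHS]mulr_natl mulrA [_ * U]mulrC Uq mul1r. Qed.

(** The probability of an edge to a fresh vertex does not depend on the label of
    the root: the degree alone carries no information about the label. *)
Lemma mean_edge l : \sum_x U * p l x = zeta.
Proof.
rewrite -big_distrr -big_distrr /= M_sum mulr1 mulrCA.
by rewrite Uq mulr1.
Qed.

Lemma mean_non_edge l : \sum_x U * (1 - p l x) = 1 - zeta.
Proof.
under eq_bigr do rewrite mulrBr mulr1.
by rewrite sumrB mean_edge sumr_const -[U *+ #|A|]mulr_natr Uq.
Qed.

Lemma zeta_le1 : zeta <= 1.
Proof.
have /card_gt0P[l _] := A_gt0.
rewrite -(mean_edge l) -[leRHS]mean_const; apply: ler_sum => x _.
by rewrite ler_wpM2l //; have /andP[] := p01 l x.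
Qed.

(** How much the absence of edges between a root of label [l] and [n] fresh
    vertices distorts their uniform law. *)
Definition deviation l n : R :=
  \sum_(s : n.-tuple A) U ^+ n * `|\prod_(x <- s) (1 - p l x) - (1 - zeta) ^+ n|.

(** The product over the missing edges has mean (1 - zeta)^n, and its variance
    is at most n times the variance of one factor.  With [beta] of order 1/n the
    variance is of order 1/n, although the sum of the absolute deviations of the
    factors is only of order 1. *)
Lemma deviation_le l n delta : 0 < delta ->
  deviation l n <= delta + n%:R * beta ^+ 2 / delta.
Proof.
move=> d0; set Z := (1 - zeta).
have UqX : U ^+ n * #|A|%:R ^+ n = 1 :> R by rewrite -exprMn Uq expr1n.
apply: (@le_trans _ _ (\sum_(s : n.-tuple A) (U ^+ n * delta +
   U ^+ n * (\prod_(x <- s) (1 - p l x) - Z ^+ n) ^+ 2 / delta))).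
  apply: ler_sum => s _; rewrite -mulrA -mulrDr ler_wpM2l ?exprn_ge0 //.
  exact: norm_le_sqr.
rewrite big_split /= sum_tuple_const mulrA [_ * U ^+ n]mulrC UqX mul1r lerD2l.
rewrite -big_distrl /= ler_pM2r ?invr_gt0 //.
have -> : \sum_(s : n.-tuple A) U ^+ n * (\prod_(x <- s) (1 - p l x) - Z ^+ n) ^+ 2
   = (\sum_x U * (1 - p l x) ^+ 2) ^+ n - (Z ^+ 2) ^+ n.
  transitivity (\sum_(s : n.-tuple A)
     (\prod_(x <- s) (U * (1 - p l x) ^+ 2)
      - (2 * Z ^+ n) * \prod_(x <- s) (U * (1 - p l x)) + U ^+ n * Z ^+ n ^+ 2)).
    apply: eq_bigr => s _; rewrite !prod_scale size_tuple prodrXl; ring.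
  rewrite big_split sumrB -big_distrr /= !sum_tuple_prod mean_non_edge.
  rewrite sum_tuple_const mulrCA mulrA UqX mul1r -/Z [in RHS]exprAC; ring.
have eS : \sum_x U * (1 - p l x) ^+ 2 = 1 - 2 * zeta + \sum_x U * p l x ^+ 2.
  transitivity (\sum_x (U - 2 * (U * p l x) + U * p l x ^+ 2)).
    by apply: eq_bigr => x _; ring.
  by rewrite big_split sumrB -big_distrr /= mean_edge sumr_const -[U *+ #|A|]mulr_natr Uq.
have V1 : \sum_x U * p l x ^+ 2 <= beta ^+ 2.
  rewrite -[leRHS]mean_const; apply: ler_sum => x _.
  have /andP[h _] := p01 l x; have h' := zeta_beta l x.
  by rewrite ler_wpM2l // lerXn2r ?nnegrE //; exact: le_trans h h'.
have V0 : zeta ^+ 2 <= \sum_x U * p l x ^+ 2.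
  have : 0 <= \sum_x U * (p l x - zeta) ^+ 2.
    by apply: sumr_ge0 => x _; rewrite mulr_ge0 ?sqr_ge0.
  have -> : \sum_x U * (p l x - zeta) ^+ 2 = \sum_x U * p l x ^+ 2 - zeta ^+ 2.
    transitivity (\sum_x (U * p l x ^+ 2 - 2 * zeta * (U * p l x) + U * zeta ^+ 2)).
      by apply: eq_bigr => x _; ring.
    rewrite big_split /= sumrB -[X in _ - X + _]mulr_sumr mean_edge mean_const.
    by ring.
  by rewrite subr_ge0.
have S1 : \sum_x U * (1 - p l x) ^+ 2 <= 1.
  rewrite -[leRHS]mean_const; apply: ler_sum => x _.
  have /andP[h h'] := p01 l x.
  by rewrite ler_wpM2l // exprn_ile1 // ?subr_ge0 ?gerBl.
apply: le_trans (expr_sub_le _ _ _ _) _ => //; first exact: sqr_ge0.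
  by rewrite eS /Z; nra.
by rewrite ler_wpM2l // eS /Z; nra.
Qed.

Lemma prod_edge_weight l s e :
  row_weight p l (nseq (size s) e) s = \prod_(x <- s) edge_weight p l x e.
Proof.
by elim: s => [|x s IH]; rewrite ?row_weight_nil ?big_nil //= row_weight_cons
  IH big_cons.
Qed.

Lemma row_weight_sorted l (sq u v : seq A) :
  row_weight p l (sorted_row (size sq) (size u) (size v)) (sq ++ u ++ v) =
  \prod_(x <- sq) (1 - p l x) * (\prod_(x <- u) p l x *
    \prod_(x <- v) (1 - p l x)).
Proof.
by rewrite !row_weight_cat ?size_nseq // !prod_edge_weight.
Qed.

Lemma peel_sorted c k t n (sq : k.-tuple A) (u : t.-tuple A) (v : n.-tuple A) :
  peel_root p (padded k.+1 (t + n) c) (sorted_row k t n) (sq ++ u ++ v) =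
  \sum_l c (l :: sq) * \prod_(x <- u) M l x * (zeta ^+ t * U ^+ n *
    (\prod_(x <- sq) (1 - p l x) * \prod_(x <- v) (1 - p l x))).
Proof.
apply: eq_bigr => l _.
rewrite /padded /= take_size_cat ?size_tuple //.
have := row_weight_sorted l sq u v; rewrite !size_tuple => ->.
have -> : \prod_(x <- u) p l x = (zeta * #|A|%:R) ^+ t * \prod_(x <- u) M l x.
  by rewrite prod_scale size_tuple.
rewrite exprD exprMn.
have UqX : U ^+ t * #|A|%:R ^+ t = 1 :> R by rewrite -exprMn Uq expr1n.
by rewrite -[RHS]mul1r -[X in _ = X * _]UqX; ring.
Qed.

Lemma padded_branch c k t n (sq : k.-tuple A) (u : t.-tuple A) (v : n.-tuple A) :
  padded (k + t) n (branch M k c) (sq ++ u ++ v) =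
  \sum_l c (l :: sq) * \prod_(x <- u) M l x * U ^+ n.
Proof.
rewrite /padded /branch catA take_size_cat ?size_cat ?size_tuple //.
rewrite take_size_cat ?drop_size_cat ?size_tuple //.
by rewrite big_distrl.
Qed.

Lemma integrate_children t n (C : A -> R) (g : A -> seq A -> R) :
  \sum_(u : t.-tuple A) \sum_(v : n.-tuple A)
    \sum_l C l * \prod_(x <- u) M l x * g l v =
  \sum_l C l * \sum_(v : n.-tuple A) g l v.
Proof.
under eq_bigr => u _.
  rewrite exchange_big /=.
  under eq_bigr => l _ do rewrite -mulr_sumr.
  over.
rewrite exchange_big; apply: eq_bigr => l _.
rewrite -mulr_suml -mulr_sumr sum_tuple_prod M_sum expr1n.
by rewrite mulr1.
Qed.

Lemma l1norm_cons k (c : seq A -> R) :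
  l1norm k.+1 c = \sum_(sq : k.-tuple A) \sum_l `|c (l :: sq)|.
Proof. by rewrite /l1norm (sum_tuple_cons (fun s => `|c s|)) exchange_big. Qed.

(** Observing a sorted row acts on densities like [branch].  The discrepancy has
    two sources: the missing edges to the distinguished vertices, which cost
    [k%:R * beta], and those to the fresh vertices, which cost [D]. *)
Lemma branch_close c k t n D : (forall l, deviation l n <= D) ->
  \sum_(s : (k + (t + n)).-tuple A)
    `|peel_root p (padded k.+1 (t + n) c) (sorted_row k t n) s -
      zeta ^+ t * (1 - zeta) ^+ n * padded (k + t) n (branch M k c) s| <=
  zeta ^+ t * (k%:R * beta + D) * l1norm k.+1 c.
Proof.
move=> devD.
rewrite (sum_tuple_cat (fun s =>
  `|peel_root p (padded k.+1 (t + n) c) (sorted_row k t n) s -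
      zeta ^+ t * (1 - zeta) ^+ n * padded (k + t) n (branch M k c) s|)).
rewrite l1norm_cons mulr_sumr; apply: ler_sum => sq _.
rewrite (sum_tuple_cat (fun s =>
  `|peel_root p (padded k.+1 (t + n) c) (sorted_row k t n) (sq ++ s) -
      zeta ^+ t * (1 - zeta) ^+ n * padded (k + t) n (branch M k c) (sq ++ s)|)).
pose g l (v : seq A) := zeta ^+ t * (U ^+ n * `|\prod_(x <- v) (1 - p l x)
  - (1 - zeta) ^+ n| + U ^+ n * (k%:R * beta)).
apply: (@le_trans _ _ (\sum_(u : t.-tuple A) \sum_(v : n.-tuple A)
    \sum_l `|c (l :: sq)| * \prod_(x <- u) M l x * g l v)).
  apply: ler_sum => u _; apply: ler_sum => v _.
  rewrite peel_sorted padded_branch mulr_sumr -sumrB.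
  apply: le_trans (ler_norm_sum _ _ _) _; apply: ler_sum => l _.
  set mu := \prod_(x <- u) M l x.
  set P := \prod_(x <- sq) _; set Q := \prod_(x <- v) _.
  have mu0 : 0 <= mu by apply: prodr_ge0.
  have /andP[P1 P2] : 1 - k%:R * beta <= P <= 1.
    by rewrite -(size_tuple sq); apply: prod_one_minus; [exact: p01 | exact: zeta_beta].
  have /andP[_ Q2] : 1 - n%:R * beta <= Q <= 1.
    by rewrite -(size_tuple v); apply: prod_one_minus; [exact: p01 | exact: zeta_beta].
  have Q0 : 0 <= Q.
    by apply: prodr_ge0 => x _; have /andP[] := p01 l x; lra.
  have -> : c (l :: sq) * mu * (zeta ^+ t * U ^+ n * (P * Q)) -
      zeta ^+ t * (1 - zeta) ^+ n * (c (l :: sq) * mu * U ^+ n) =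
      c (l :: sq) * mu * (zeta ^+ t * (U ^+ n * (P * Q - (1 - zeta) ^+ n))) by ring.
  rewrite 2!normrM (ger0_norm mu0) ler_wpM2l ?mulr_ge0 //.
  rewrite /g normrM ger0_norm ?exprn_ge0 // ler_wpM2l ?exprn_ge0 //.
  rewrite -mulrDr normrM ger0_norm ?exprn_ge0 // ler_wpM2l ?exprn_ge0 //.
  have -> : P * Q - (1 - zeta) ^+ n = (Q - (1 - zeta) ^+ n) + - ((1 - P) * Q) by ring.
  apply: le_trans (ler_normD _ _) _; rewrite lerD2l normrN ger0_norm.
    by nra.
  by rewrite mulr_ge0 // subr_ge0.
rewrite (integrate_children _ _ (fun l => `|c (l :: sq)|) g) mulr_sumr.
apply: ler_sum => l _; rewrite mulrC ler_wpM2r //.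
rewrite -mulr_sumr ler_wpM2l ?exprn_ge0 // big_split /=.
have UqX : U ^+ n * #|A|%:R ^+ n = 1 :> R by rewrite -exprMn Uq expr1n.
rewrite sum_tuple_const (mulrA (#|A|%:R ^+ n)) [_ * U ^+ n]mulrC UqX mul1r.
rewrite [leRHS]addrC lerD2r.
exact: devD.
Qed.

(** Serves to bound from above the total probability of the rows that
    [branch_close] does not treat. *)
Lemma peel_mass c k t n :
  (1 - k%:R * beta) * (zeta ^+ t * (1 - zeta) ^+ n) * l1norm k.+1 c <=
  \sum_(s : (k + (t + n)).-tuple A)
    peel_root p (padded k.+1 (t + n) (fun s => `|c s|)) (sorted_row k t n) s.
Proof.
rewrite (sum_tuple_cat (fun s =>
  peel_root p (padded k.+1 (t + n) (fun s => `|c s|)) (sorted_row k t n) s)).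
rewrite l1norm_cons mulr_sumr; apply: ler_sum => sq _.
rewrite (sum_tuple_cat (fun s =>
  peel_root p (padded k.+1 (t + n) (fun s => `|c s|)) (sorted_row k t n) (sq ++ s))).
pose g l (v : seq A) := zeta ^+ t * U ^+ n * (\prod_(x <- sq) (1 - p l x) *
  \prod_(x <- v) (1 - p l x)).
under [leRHS]eq_bigr => u _ do under eq_bigr => v _ do rewrite peel_sorted.
rewrite (integrate_children _ _ (fun l => `|c (l :: sq)|) g) mulr_sumr.
apply: ler_sum => l _; rewrite mulrC ler_wpM2l //.
rewrite /g -!mulr_sumr sum_tuple_prod.
have -> : \sum_x (1 - p l x) = #|A|%:R * (1 - zeta).
  by rewrite -(mean_non_edge l) -mulr_sumr mulrA [_ * U]mulrC Uq mul1r.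
have UqX : U ^+ n * #|A|%:R ^+ n = 1 :> R by rewrite -exprMn Uq expr1n.
rewrite exprMn.
have -> : zeta ^+ t * U ^+ n * (\prod_(i <- sq) (1 - p l i) *
  (#|A|%:R ^+ n * (1 - zeta) ^+ n)) =
  \prod_(i <- sq) (1 - p l i) * (zeta ^+ t * (1 - zeta) ^+ n).
  by rewrite -[RHS]mul1r -[X in _ = X * _]UqX; ring.
apply: ler_wpM2r; first by rewrite mulr_ge0 ?exprn_ge0 // subr_ge0 zeta_le1.
have := @prod_one_minus R A (p l) beta sq (p01 l) (zeta_beta l).
by rewrite size_tuple => /andP[].
Qed.

Lemma mask_self (b : bitseq) : mask b b = nseq (count id b) true.
Proof. by elim: b => [|[] b IH] //=; rewrite IH. Qed.

Lemma mask_negb_self (b : bitseq) :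
  mask (map negb b) b = nseq (size b - count id b) false.
Proof.
elim: b => [|[] b IH] //=; rewrite IH //.
by rewrite add0n subSn // count_size.
Qed.

Lemma row_weight_swaps l ks (b : bitseq) (s : seq A) : size b = size s ->
  row_weight p l (swaps ks b) (swaps ks s) = row_weight p l b s.
Proof.
move=> e; elim: ks => //= k ks IH.
by rewrite row_weight_swap_at ?size_swaps.
Qed.

(** Fresh vertices are exchangeable, so only the number of neighbours among
    them matters. *)
Lemma peel_sort_row k (bo : bitseq) : exists ks, forall c (s : seq A),
  size s = (k + size bo)%N ->
  peel_root p (padded k.+1 (size bo) c) (nseq k false ++ bo) s =
  peel_root p (padded k.+1 (size bo) c)
    (sorted_row k (count id bo) (size bo - count id bo)) (swaps ks s).
Proof.
have [ks Hks] := partition_swaps (nseq k true ++ bo).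
have swapsE (T : Type) (sq o : seq T) : size sq = k -> size o = size bo ->
    swaps ks (sq ++ o) = sq ++ mask bo o ++ mask (map negb bo) o.
  move=> sk so; rewrite Hks ?size_cat ?size_nseq ?sk ?so //.
  rewrite map_cat map_nseq !mask_cat ?size_nseq //.
  by rewrite -sk mask_true // mask_false /= catA.
exists ks => c s sz.
have szk : size (take k s) = k by rewrite size_takel // sz leq_addr.
have szd : size (drop k s) = size bo by rewrite size_drop sz addKn.
apply: eq_bigr => l _; congr (_ * _).
  rewrite /padded /= -{2}(cat_take_drop k s) swapsE //.
  by rewrite take_size_cat.
rewrite -(@row_weight_swaps _ ks); last by rewrite size_cat size_nseq sz.
by rewrite swapsE ?size_nseq // mask_self mask_negb_self.
Qed.

(** Rows without edges to the distinguished vertices and with [t <= K] fresh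
    neighbours are treated by [branch_close]; there are 'C(N, t) of them for
    each [t].  On all other rows the norm is bounded by the probability mass,
    which is the total mass minus that of the rows already treated. *)
Lemma peel_ineq k N K c D : (K <= N)%N ->
  (forall l t, (t <= K)%N -> deviation l (N - t) <= D) ->
  graph_norm p (k.+1 + N) (padded k.+1 N c) <=
  \sum_(t < K.+1) 'C(N, t)%:R * (zeta ^+ t * ((1 - zeta) ^+ (N - t) *
      graph_norm p (k + N) (padded (k + t) (N - t) (branch M k c)) +
      (k%:R * beta + D) * l1norm k.+1 c)) +
  (1 - (1 - k%:R * beta) *
    \sum_(t < K.+1) 'C(N, t)%:R * (zeta ^+ t * (1 - zeta) ^+ (N - t))) *
  l1norm k.+1 c.
Proof.
move=> KN devD.
set F := padded k.+1 N c.
pose g b := graph_norm p (k + N) (peel_root p F b).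
pose m b := \sum_(s : (k + N).-tuple A)
  peel_root p (padded k.+1 N (fun s => `|c s|)) b s.
have gm b : g b <= m b.
  apply: le_trans (graph_norm_le_l1 p01 _ _) _; apply: ler_sum => s _.
  apply: le_trans (ler_norm_sum _ _ _) _; apply: ler_sum => l _.
  rewrite normrM (ger0_norm (row_weight_ge0 p01 _ _ _)) ler_wpM2r //.
    exact: row_weight_ge0.
  by rewrite /F /padded normrM (ger0_norm (exprn_ge0 _ _)).
have mE : \sum_(b : (k + N).-tuple bool) m b = l1norm k.+1 c.
  rewrite exchange_big /=.
  transitivity (\sum_(s : (k + N).-tuple A)
    \sum_l `|c (l :: take k s)| * U ^+ N).
    apply: eq_bigr => s _; rewrite exchange_big; apply: eq_bigr => l _ /=.
    by rewrite -mulr_sumr sum_row_weight ?size_tuple // mulr1.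
  rewrite (sum_tuple_cat (fun s => \sum_l `|c (l :: take k s)| * U ^+ N)).
  rewrite l1norm_cons; apply: eq_bigr => sq _.
  have UqX : #|A|%:R ^+ N * U ^+ N = 1 :> R by rewrite -exprMn [_ * U]mulrC Uq expr1n.
  rewrite -[RHS]mul1r -[X in _ = X * _]UqX -mulrA.
  rewrite -sum_tuple_const; apply: eq_bigr => o _.
  by rewrite take_size_cat ?size_tuple // mulr_sumr; apply: eq_bigr => l _; rewrite mulrC.
pose z : bitseq := nseq k false.
(* Bounding [g] by the mass [m] on a bad row loses [m - g]; restricted to the
   good rows, the same nonnegative quantity is what their treatment gains. *)
have split_good : \sum_(b : (k + N).-tuple bool) (m b - g b) >=
    \sum_(bo : N.-tuple bool | (count id bo <= K)%N) (m (z ++ bo) - g (z ++ bo)).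
  rewrite (sum_tuple_cat (fun b => m b - g b)).
  rewrite (bigD1 [tuple of nseq k false]) //= -/z.
  apply: ler_wpDr; first by do 2!(apply: sumr_ge0 => ? _); rewrite subr_ge0.
  rewrite [leRHS](bigID (fun bo : N.-tuple bool => (count id bo <= K)%N)) /=.
  by apply: ler_wpDr => //; apply: sumr_ge0 => bo _; rewrite subr_ge0.
have gE : graph_norm p (k.+1 + N) F = \sum_(b : (k + N).-tuple bool) g b by [].
rewrite gE -[leLHS](subKr (\sum_(b : (k + N).-tuple bool) m b)) -sumrB.
apply: le_trans (lerB (lexx _) split_good) _.
rewrite mE sumrB opprB addrC.
have good_m : (1 - k%:R * beta) * (\sum_(t < K.+1) 'C(N, t)%:R *
   (zeta ^+ t * (1 - zeta) ^+ (N - t))) * l1norm k.+1 c <=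
   \sum_(bo : N.-tuple bool | (count id bo <= K)%N) m (z ++ bo).
  rewrite -(sum_count_le _ _ (fun t => zeta ^+ t * (1 - zeta) ^+ (N - t))).
  rewrite mulrAC mulr_sumr; apply: ler_sum => bo cK; rewrite mulrAC.
  have [ks Hks] := peel_sort_row k bo.
  rewrite /m; under [leRHS]eq_bigr => s _.
    rewrite -[N in padded _ N](size_tuple bo) Hks; last by rewrite !size_tuple.
    over.
  rewrite size_tuple.
  have eN : (count id bo + (N - count id bo))%N = N by rewrite subnKC // (leq_trans cK).
  rewrite (sum_tuple_swaps ks (fun s => peel_root p (padded k.+1 N (fun s => `|c s|))
    (sorted_row k (count id bo) (N - count id bo)) s)).
  have := peel_mass c k (count id bo) (N - count id bo).
  by rewrite eN.
have good_g : \sum_(bo : N.-tuple bool | (count id bo <= K)%N) g (z ++ bo) <=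
   \sum_(t < K.+1) 'C(N, t)%:R * (zeta ^+ t * ((1 - zeta) ^+ (N - t) *
      graph_norm p (k + N) (padded (k + t) (N - t) (branch M k c)) +
      (k%:R * beta + D) * l1norm k.+1 c)).
  rewrite -(sum_count_le _ _ (fun t => zeta ^+ t * ((1 - zeta) ^+ (N - t) *
      graph_norm p (k + N) (padded (k + t) (N - t) (branch M k c)) +
      (k%:R * beta + D) * l1norm k.+1 c))).
  apply: ler_sum => bo cK.
  have [ks Hks] := peel_sort_row k bo.
  have -> : g (z ++ bo) = graph_norm p (k + N) (fun s =>
      peel_root p F (sorted_row k (count id bo) (N - count id bo)) (swaps ks s)).
    apply: eq_graph_norm => s sz.
    by have := Hks c s; rewrite size_tuple => ->.
  rewrite (graph_norm_swaps psym _ _ (fun s => peel_root p F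
    (sorted_row k (count id bo) (N - count id bo)) s)).
  set t := count id bo.
  have eN : (t + (N - t))%N = N by rewrite subnKC // (leq_trans cK).
  apply: le_trans (graph_norm_close p01 _ _ (fun s => zeta ^+ t *
    (1 - zeta) ^+ (N - t) * padded (k + t) (N - t) (branch M k c) s)) _.
  rewrite graph_normZ ger0_norm; last first.
    by rewrite mulr_ge0 ?exprn_ge0 // subr_ge0 zeta_le1.
  rewrite [leRHS]mulrDr !mulrA lerD2l.
  have := @branch_close c k t (N - t) D (fun l => devD l t cK).
  by rewrite eN.
by rewrite mulrBl mul1r addrA; lra.
Qed.

End Peel.

(** * The limit of large sparse graphs *)

Section PoissonLimit.
Context (R : realType).

Lemma cvg_sum_ord n (f : 'I_n -> nat -> R) (l : 'I_n -> R) :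
  (forall i, f i m @[m --> \oo] --> l i) ->
  \sum_(i < n) f i m @[m --> \oo] --> \sum_(i < n) l i.
Proof. by move=> h; apply: cvg_big => //; exact: add_continuous. Qed.

Lemma cvg_div_nat (x : R) : (fun n : nat => x / n%:R) @ \oo --> (0 : R).
Proof.
rewrite -(mulr0 x).
apply: cvgM; first exact: cvg_cst.
by have := @cvg_harmonic R; rewrite /harmonic (@cvg_shiftS _ (fun n : nat => (n%:R)^-1 : R)).
Qed.

Lemma cvg_sub_div_nat j : (fun n : nat => (n - j)%:R / n%:R : R) @ \oo --> (1 : R).
Proof.
have h : (fun n : nat => 1 - j%:R / n%:R : R) @ \oo --> (1 : R).
  by rewrite -[X in _ --> X](subr0 (1 : R)); apply: cvgB; [exact: cvg_cst | exact: cvg_div_nat].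
apply: cvg_trans h; apply: near_eq_cvg; near=> n.
have n0 : (0 < n)%N by near: n; exact: nbhs_infty_ge.
have nj : (j <= n)%N by near: n; exact: nbhs_infty_ge.
by rewrite natrB // mulrBl divff // pnatr_eq0 -lt0n.
Unshelve. all: by end_near. Qed.

Lemma cvg_binomial_coef (d : R) j t :
  (fun n : nat => 'C(n - j, t)%:R * (d / n%:R) ^+ t) @ \oo --> d ^+ t / t`!%:R.
Proof.
have h : (fun n : nat => ((n - j) ^_ t)%:R / n%:R ^+ t : R) @ \oo --> (1 : R).
  elim: t => [|t IH].
    by under eq_fun do rewrite ffactn0 expr0 divr1; exact: cvg_cst.
  rewrite -[X in _ --> X](mulr1 (1 : R)).
  under eq_fun do rewrite ffactnSr -subnDA natrM exprSr invfM mulrACA.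
  by apply: cvgM => //; exact: cvg_sub_div_nat.
have e : (fun n : nat => 'C(n - j, t)%:R * (d / n%:R) ^+ t) =
   (fun n : nat => ((n - j) ^_ t)%:R / n%:R ^+ t * (d ^+ t / t`!%:R)).
  apply/funext => n; rewrite -bin_ffact natrM expr_div_n.
  have t0 : t`!%:R != 0 :> R by rewrite pnatr_eq0 -lt0n fact_gt0.
  by move: (n%:R ^+ t)^-1 => y; field.
rewrite e -[X in _ --> X]mul1r.
by apply: cvgM => //; exact: cvg_cst.
Qed.

(** Squeezed between two exponentials, both obtained from 1 + x <= exp x; the
    lower one uses it in the form 1 / (1 - x) <= exp (x / (1 - x)). *)
Lemma cvg_one_minus_pow (d : R) j : 0 < d ->
  (fun n : nat => (1 - d / n%:R) ^+ (n - j)) @ \oo --> expR (- d).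
Proof.
move=> d0.
have up : (fun n : nat => expR (- (d * ((n - j)%:R / n%:R)))) @ \oo --> expR (- d).
  apply: (continuous_cvg _ (@continuous_expR R _)).
  rewrite -[X in _ --> - X](mulr1 d); apply: cvgN; apply: cvgM; first exact: cvg_cst.
  exact: cvg_sub_div_nat.
have low : (fun n : nat => expR (- (d / (1 - d / n%:R)))) @ \oo --> expR (- d).
  apply: (continuous_cvg _ (@continuous_expR R _)).
  rewrite -[X in _ --> - X](divr1 d); apply: cvgN; apply: cvgM; first exact: cvg_cst.
  apply: cvgV; first by rewrite oner_eq0.
  by rewrite -[X in _ --> X](subr0 (1 : R)); apply: cvgB; [exact: cvg_cst | exact: cvg_div_nat].
apply: squeeze_cvgr low up; near=> n.
have n0 : (0 < n)%N by near: n; exact: nbhs_infty_ge.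
have nd : d < n%:R by near: n; exact: nbhs_infty_gtr.
have n0' : 0 < n%:R :> R by rewrite ltr0n.
have x1 : d / n%:R < 1 by rewrite ltr_pdivrMr ?mul1r.
have x0 : 0 < d / n%:R by rewrite divr_gt0.
apply/andP; split; last first.
  rewrite mulrCA -[X in expR X]mulrN expRM_natl.
  rewrite lerXn2r ?nnegrE ?expR_ge0 ?subr_ge0 ?(ltW x1) //.
  exact: expR_ge1Dx.
apply: (@le_trans _ _ ((1 - d / n%:R) ^+ n)); last first.
  by apply: ler_wiXn2l; rewrite ?leq_subr ?subr_ge0 ?gerBl ?(ltW x1) ?(ltW x0).
set x := d / n%:R in x0 x1 *.
have -> : d / (1 - x) = n%:R * (x / (1 - x)).
  by rewrite mulrA /x mulrCA divff ?mulr1 // gt_eqF.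
rewrite -mulrN expRM_natl lerXn2r ?nnegrE ?expR_ge0 ?subr_ge0 ?(ltW x1) //.
rewrite expRN invf_ple ?posrE ?expR_gt0 ?subr_gt0 //.
apply: le_trans (expR_ge1Dx _).
have y0 : 1 - x != 0 by rewrite gt_eqF // subr_gt0.
by rewrite -[X in _ <= X + _](divff y0) -mulrDl subrK mul1r.
Unshelve. all: by end_near. Qed.

End PoissonLimit.

Section AsymptoticBound.
Context (R : realType) (A : finType) (M : A -> A -> R) (d : R).

Definition sparse_edge (n : nat) : A -> A -> R := kernel_edge M (d / n%:R).

(** The number of fresh vertices decreases during the exploration by an amount
    that depends on the number of children found, while the edge probabilities
    remain those of the initial graph on [n] vertices.  Quantifying over the
    number [j] of vertices used up makes the bound stable under exposures. *)
Definition asym_le k (c : seq A -> R) (x : R) : Prop :=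
  forall j e, 0 < e -> \forall n \near \oo,
    graph_norm (sparse_edge n) (k + (n - j)) (padded k (n - j) c) <= x + e.

Hypothesis A_gt0 : (0 < #|A|)%N.
Hypothesis M_ge0 : forall l x, 0 <= M l x.
Hypothesis M_sum : forall l, \sum_x M l x = 1.
Hypothesis M_sym : forall l x, M l x = M x l.
Hypothesis d_gt0 : 0 < d.

Let B : R := d * #|A|%:R.

Let M_le1 l x : M l x <= 1.
Proof. by rewrite -(M_sum l) (bigD1 x) //= lerDl sumr_ge0. Qed.

Let B_gt0 : 0 < B.
Proof. by rewrite mulr_gt0 ?ltr0n. Qed.

Let edge_leB n l x : kernel_edge M (d / n%:R) l x <= B / n%:R.
Proof.
rewrite /kernel_edge /B [d * _ / _]mulrAC ler_piMr // !mulr_ge0 ?ler0n ?invr_ge0 //.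
exact: ltW.
Qed.

Lemma sparse_edge01 : \forall n \near \oo, forall l x, 0 <= sparse_edge n l x <= 1.
Proof.
near=> n => l x; rewrite /sparse_edge /kernel_edge !mulr_ge0 ?ler0n ?invr_ge0 ?(ltW d_gt0) //=.
apply: le_trans (edge_leB n l x) _.
have nB : B < n%:R by near: n; exact: nbhs_infty_gtr.
by rewrite ler_pdivrMr ?mul1r ?(ltW nB) // (lt_trans B_gt0).
Unshelve. all: by end_near. Qed.

Lemma l1norm_padded k N (c : seq A -> R) :
  \sum_(s : (k + N).-tuple A) `|padded k N c s| = l1norm k c.
Proof.
rewrite (sum_tuple_cat (fun s => `|padded k N c s|)) /l1norm.
apply: eq_bigr => sq _; rewrite /padded.
under eq_bigr => o _ do rewrite take_size_cat ?size_tuple //.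
have U0 : 0 <= #|A|%:R^-1 ^+ N :> R by rewrite exprn_ge0 ?invr_ge0 ?ler0n.
rewrite sum_tuple_const normrM (ger0_norm U0).
by rewrite mulrCA -exprMn mulfV ?expr1n ?mulr1 // pnatr_eq0 -lt0n.
Qed.

Lemma asym_le_l1norm k c : asym_le k c (l1norm k c).
Proof.
move=> j e e0; near=> n.
have p01 : forall l x, 0 <= sparse_edge n l x <= 1 by near: n; exact: sparse_edge01.
apply: le_trans (graph_norm_le_l1 p01 _ _) _.
by rewrite l1norm_padded lerDl ltW.
Unshelve. all: by end_near. Qed.

Lemma asym_le_mono k c x y : x <= y -> asym_le k c x -> asym_le k c y.
Proof.
move=> xy h j e e0; move: (h j e e0); apply: filterS => n hn.
by apply: le_trans hn _; rewrite lerD2r.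
Qed.

Lemma eq_asym_le k c c' x : (forall s, size s = k -> c s = c' s) ->
  asym_le k c x -> asym_le k c' x.
Proof.
move=> cc' h j e e0; move: (h j e e0); apply: filterS => n.
rewrite (@eq_graph_norm _ _ _ _ _ (padded k (n - j) c')) // => s sz.
by rewrite /padded cc' // size_takel // sz leq_addr.
Qed.

Local Notation pois := (poisson_pmf d).

(** Passage to the limit in [peel_ineq]: binomial weights become Poisson weights
    and the error terms vanish, except for the event that the root has more
    than [K] children, on which the trivial bound [l1norm] is used. *)
Lemma asym_le_peel k K c (x : nat -> R) :
  (forall t, (t <= K)%N -> asym_le (k + t) (branch M k c) (x t)) ->
  asym_le k.+1 c (\sum_(t < K.+1) pois t * x t +
    (1 - \sum_(t < K.+1) pois t) * l1norm k.+1 c).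
Proof.
move=> hx j e e0.
set L := l1norm k.+1 c.
have L0 : 0 <= L by apply: sumr_ge0.
set S := \sum_(t < K.+1) pois t.
have S0 : 0 <= S by apply: sumr_ge0 => t _; exact: poisson_pmf_ge0.
set S' := \sum_(t < K.+1) d ^+ t / t`!%:R.
have S'0 : 0 <= S'.
  by apply: sumr_ge0 => t _; rewrite mulr_ge0 ?invr_ge0 ?ler0n ?exprn_ge0 ?ltW.
(* The slack [e1] in the bounds for the children and the parameter [del] of
   [deviation_le] each shift the limit by at most e / 3. *)
pose e1 := e / 3 / (1 + S).
have e10 : 0 < e1 by rewrite !divr_gt0 // ltr_wpDr.
pose del := e / 3 / (1 + S' * L).
have del0 : 0 < del by rewrite !divr_gt0 // ltr_wpDr // mulr_ge0.
pose alpha t (n : nat) : R := 'C(n - j, t)%:R * (d / n%:R) ^+ t *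
  (1 - d / n%:R) ^+ (n - j - t).
pose gam t (n : nat) : R := 'C(n - j, t)%:R * (d / n%:R) ^+ t.
pose err (n : nat) : R := k%:R * (B / n%:R) + (del + B ^+ 2 / del / n%:R).
pose rhs (n : nat) := \sum_(t < K.+1) (alpha t n * (x t + e1) + gam t n * (err n * L)) +
   (1 - (1 - k%:R * (B / n%:R)) * \sum_(t < K.+1) alpha t n) * L.
have alpha_cvg t : alpha t n @[n --> \oo] --> pois t.
  rewrite /poisson_pmf d_gt0; apply: cvgM; first exact: cvg_binomial_coef.
  under eq_fun do rewrite -subnDA.
  exact: cvg_one_minus_pow.
have kB0 : (fun n : nat => k%:R * (B / n%:R)) @ \oo --> (0 : R).
  by rewrite -(mulr0 k%:R); apply: cvgM; [exact: cvg_cst | exact: cvg_div_nat].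
have err_cvg : err n @[n --> \oo] --> del.
  rewrite -[X in _ --> X]add0r; apply: cvgD => //.
  rewrite -[X in _ --> X]addr0; apply: cvgD; first exact: cvg_cst.
  exact: cvg_div_nat.
have rhs_cvg : rhs n @[n --> \oo] -->
   \sum_(t < K.+1) (pois t * (x t + e1) + d ^+ t / t`!%:R * (del * L)) +
   (1 - (1 - 0) * \sum_(t < K.+1) pois t) * L.
  apply: cvgD.
    apply: cvg_sum_ord => t; apply: cvgD; apply: cvgM => //; first exact: cvg_cst.
      exact: cvg_binomial_coef.
    by apply: cvgM => //; exact: cvg_cst.
  apply: cvgM; last exact: cvg_cst.
  apply: cvgB; first exact: cvg_cst.
  apply: cvgM; first by apply: cvgB => //; exact: cvg_cst.
  by apply: cvg_sum_ord => t.
set lim := (X in _ --> X) in rhs_cvg.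
set goal := (X in X + e).
have lim_lt : lim < goal + e.
  have -> : lim = goal + (S * e1 + S' * L * del).
    rewrite /lim /goal big_split /=.
    under eq_bigr do rewrite mulrDr.
    rewrite big_split /= -!mulr_suml -/S -/S'; ring.
  have h1 : S * e1 <= e / 3.
    by rewrite /e1 mulrCA ler_piMr ?divr_ge0 ?ltW // ltr_pdivrMr ?ltr_wpDr // mul1r ltrDr.
  have h2 : S' * L * del <= e / 3.
    have SL0 : 0 <= S' * L by rewrite mulr_ge0.
    by rewrite /del mulrCA ler_piMr ?divr_ge0 ?ltW // ltr_pdivrMr ?ltr_wpDr // mul1r ltrDr.
  by lra.
near=> n.
have n0 : (0 < n)%N by near: n; exact: nbhs_infty_ge.
have n0' : 0 < n%:R :> R by rewrite ltr0n.
have jn : (j + K <= n)%N by near: n; exact: nbhs_infty_ge.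
have nB : B < n%:R by near: n; exact: nbhs_infty_gtr.
have B1 : B / n%:R <= 1 by rewrite ler_pdivrMr // mul1r ltW.
have zeta0 : 0 <= d / n%:R by rewrite divr_ge0 // ltW.
have Hn : forall t : 'I_K.+1, graph_norm (sparse_edge n) (k + t + (n - (j + t)))
    (padded (k + t) (n - (j + t)) (branch M k c)) <= x t + e1.
  near: n; apply: filter_forall => t.
  by apply: hx => //; rewrite -ltnS ltn_ord.
have devD l t : (t <= K)%N ->
    deviation M (d / n%:R) l (n - j - t) <= del + B ^+ 2 / del / n%:R.
  move=> tK.
  apply: le_trans (deviation_le A_gt0 M_ge0 M_sum zeta0 (edge_leB n) B1 _ _ del0) _.
  rewrite lerD2l [leRHS]mulrAC ler_pM2r ?invr_gt0 //.
  rewrite expr_div_n expr2 [leRHS](_ : _ = n%:R * (B ^+ 2 / (n%:R * n%:R))).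
    by rewrite ler_wpM2r ?ler_nat ?divr_ge0 ?sqr_ge0 ?mulr_ge0 // -subnDA leq_subr.
  by rewrite -expr2; field; rewrite gt_eqF.
have KN : (K <= n - j)%N by rewrite leq_subRL ?(leq_trans _ jn) ?leq_addr.
apply: le_trans (peel_ineq A_gt0 M_ge0 M_sum M_sym zeta0 (edge_leB n) B1 k c KN devD) _.
apply: (@le_trans _ _ (rhs n)); last first.
  by near: n; exact: cvgr_le rhs_cvg _ lim_lt.
rewrite /rhs; apply: lerD; last first.
  by rewrite /alpha; under eq_bigr do rewrite mulrA.
apply: ler_sum => t _; rewrite mulrA mulrDr /alpha /gam lerD //.
rewrite [leLHS]mulrA; apply: ler_wpM2l.
  rewrite !mulr_ge0 ?ler0n ?exprn_ge0 // subr_ge0.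
  exact: zeta_le1 A_gt0 M_ge0 M_sum zeta0 (edge_leB n) B1.
apply: le_trans (Hn t).
rewrite subnDA -addnA subnKC //.
by rewrite (leq_trans _ KN) // -ltnS ltn_ord.
Unshelve. all: by end_near. Qed.

End AsymptoticBound.

(** * Iterating the exploration over generations *)

Lemma poisson_partial_sum_le1 (R : realType) (d : R) K : 0 < d ->
  \sum_(t < K) poisson_pmf d t <= 1.
Proof.
move=> d0; rewrite /poisson_pmf d0 -mulr_suml expRN ler_pdivrMr ?expR_gt0 // mul1r.
have -> : \sum_(t < K) d ^+ t / t`!%:R = series (exp_coeff d) K.
  by rewrite seriesEord; apply: eq_bigr => i _; rewrite /exp_coeff.
apply: (@nondecreasing_cvgn_le _ (series (exp_coeff d))); last exact: is_cvg_series_exp_coeff.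
apply: nondecreasing_series => i _ _.
by rewrite /exp_coeff divr_ge0 ?ler0n // exprn_ge0 // ltW.
Qed.

Section Branches.
Context (R : realType) (A : finType) (M : A -> A -> R).
Hypothesis M_ge0 : forall l x, 0 <= M l x.
Hypothesis M_sum : forall l, \sum_x M l x = 1.

(** Exposes a whole generation: the vertices are peeled one after the other, the
    successive numbers of children being listed in [kap].  The children wait at
    the end of the list; [e] counts those that are already there. *)
Fixpoint branches (kap : seq nat) (e : nat) (c : seq A -> R) : seq A -> R :=
  if kap is t :: kap' then
    branches kap' (e + t) (branch M (size kap' + e) c)
  else c.

(** The broadcast transition probability from the labels [L] of a generation to
    the labels [s] of the next one, [reshape] grouping siblings. *)
Definition level_weight (L : seq A) (kap : seq nat) (s : seq A) : R :=
  \prod_(y <- zip L (reshape kap s)) \prod_(x <- y.2) M y.1 x.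

Lemma branchesE kap e c (E s : seq A) : size E = e -> size s = sumn kap ->
  branches kap e c (E ++ s) =
  \sum_(L : (size kap).-tuple A) c (L ++ E) * level_weight L kap s.
Proof.
elim: kap e c E s => [|t kap IH] e c E s sE /=.
  move=> /size0nil ->; rewrite cats0.
  rewrite (sum_tuple0 (fun L => c (L ++ E) * level_weight L [::] [::])).
  by rewrite /level_weight big_nil mulr1.
move=> ss; rewrite -{1}(cat_take_drop t s) catA.
have st : size (take t s) = t by rewrite size_takel // ss leq_addr.
rewrite IH ?size_cat ?sE ?st //; last by rewrite size_drop ss addKn.
rewrite (sum_tuple_cons (fun L => c (L ++ E) * level_weight L (t :: kap) s)).
rewrite exchange_big; apply: eq_bigr => L _.
rewrite /branch catA take_size_cat ?drop_size_cat ?size_cat ?size_tuple ?sE //.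
rewrite mulr_suml; apply: eq_bigr => l _.
by rewrite /level_weight /= big_cons mulrA.
Qed.

(** The children are obtained from the root by a Markov kernel. *)
Lemma l1norm_branch k t c : l1norm (k + t) (branch M k c) <= l1norm k.+1 c.
Proof.
rewrite /l1norm (sum_tuple_cat (fun s => `|branch M k c s|)) -/(l1norm _ _) l1norm_cons.
apply: ler_sum => sq _.
apply: (@le_trans _ _ (\sum_(u : t.-tuple A) \sum_l
    `|c (l :: sq)| * \prod_(x <- u) M l x)).
  apply: ler_sum => u _; rewrite /branch.
  rewrite take_size_cat ?drop_size_cat ?size_tuple //.
  apply: le_trans (ler_norm_sum _ _ _) _; apply: ler_sum => l _.
  rewrite normrM [X in _ * X]ger0_norm //.
  by apply: prodr_ge0.
rewrite exchange_big; apply: ler_sum => l _.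
by rewrite -mulr_sumr sum_tuple_prod M_sum expr1n mulr1.
Qed.

Lemma l1norm_branches kap e c :
  l1norm (e + sumn kap) (branches kap e c) <= l1norm (size kap + e) c.
Proof.
elim: kap e c => [|t kap IH] e c /=; first by rewrite addn0.
rewrite addnA; apply: le_trans (IH _ _) _; rewrite addnA.
exact: l1norm_branch.
Qed.

End Branches.

Section Witness.
Context (R : realType) (A : finType) (M : A -> A -> R) (d : R).
Hypothesis A_gt0 : (0 < #|A|)%N.
Hypothesis M_ge0 : forall l x, 0 <= M l x.
Hypothesis M_sum : forall l, \sum_x M l x = 1.
Hypothesis M_sym : forall l x, M l x = M x l.
Hypothesis d_gt0 : 0 < d.
Variable lv : A.
Local Notation pois := (poisson_pmf d).
Implicit Types (c : seq A -> R).

Lemma asym_le_swap k c x :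
  asym_le M d k.+2 (fun s => c (swap_at 0 s)) x -> asym_le M d k.+2 c x.
Proof.
move=> h j e e0; move: (h j e e0); apply: filterS => n.
rewrite -(@graph_norm_swap_at _ _ (sparse_edge M d n) _ _ 0 (padded k.+2 (n - j) c)).
  by rewrite (@eq_graph_norm _ _ _ _ _
    (fun s => padded k.+2 (n - j) c (swap_at 0 s))) // => -[|y [|z s]].
by move=> l y; rewrite /sparse_edge /kernel_edge M_sym.
Qed.

(** An additional vertex with the known label [lv] at the head of the list.  It is
    never exposed as a root; summing over [lv] afterwards gives the
    information contained in the graph together with the label of this vertex. *)
Definition witness c (s : seq A) : R :=
  if s is y :: s' then (y == lv)%:R * c s' else 0.

Lemma l1norm_witness k c : l1norm k.+1 (witness c) = l1norm k c.
Proof.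
rewrite l1norm_cons; apply: eq_bigr => s _.
rewrite (bigD1 lv) //= eqxx mul1r big1 ?addr0 // => l /negbTE ->.
by rewrite mul0r normr0.
Qed.

Definition asym_wit k c x := asym_le M d k.+1 (witness c) x.

(** The witness stands at the head of the list, where it would be peeled next;
    exchanging it with the root brings the root to the front. *)
Lemma asym_wit_peel k K c (x : nat -> R) :
  (forall t, (t <= K)%N -> asym_wit (k + t) (branch M k c) (x t)) ->
  asym_wit k.+1 c (\sum_(t < K.+1) pois t * x t +
    (1 - \sum_(t < K.+1) pois t) * l1norm k.+1 c).
Proof.
move=> h; apply: asym_le_swap.
have -> : l1norm k.+1 c = l1norm k.+2 (fun s => witness c (swap_at 0 s)).
  by rewrite -l1norm_witness /l1norm (sum_tuple_swap_at 0 (fun s => `|witness c s|)).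
apply: asym_le_peel => // t tK.
apply: eq_asym_le (h t tK) => -[//|y s] _.
rewrite /witness /branch /= mulr_sumr.
by apply: eq_bigr => l _; rewrite mulrA.
Qed.

Local Notation Q K := (\sum_(t < K.+1) pois t).

Definition offspring_weight (kap : seq nat) : R := \prod_(t <- kap) pois t.

Lemma sum_offspring_weight K k :
  \sum_(kap : k.-tuple 'I_K.+1) offspring_weight (map val kap) = Q K ^+ k.
Proof.
rewrite -sum_tuple_prod; apply: eq_bigr => kap _.
by rewrite /offspring_weight big_map.
Qed.

Lemma asym_wit_level K k e c (x : seq nat -> R) :
  (forall kap : k.-tuple 'I_K.+1,
     asym_wit (e + sumn (map val kap)) (branches M (map val kap) e c) (x (map val kap))) ->
  asym_wit (k + e) c (\sum_(kap : k.-tuple 'I_K.+1)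
     offspring_weight (map val kap) * x (map val kap) +
     (1 - Q K ^+ k) * l1norm (k + e) c).
Proof.
elim: k e c x => [|k IH] e c x h.
  rewrite (sum_tuple0 (fun kap => offspring_weight (map val kap) * x (map val kap))).
  rewrite /offspring_weight big_nil mul1r expr0 subrr mul0r addr0.
  by have := h [tuple]; rewrite /= addn0.
have hp t : (t <= K)%N -> asym_wit (k + e + t) (branch M (k + e) c)
  (\sum_(kap : k.-tuple 'I_K.+1) offspring_weight (map val kap) * x (t :: map val kap)
   + (1 - Q K ^+ k) * l1norm (k + (e + t)) (branch M (k + e) c)).
  move=> tK; rewrite -addnA; apply: (IH _ _ (fun kap => x (t :: kap))) => kap.
  have := h [tuple of Ordinal (tK : (t < K.+1)%N) :: kap].
  by rewrite /= addnA size_map size_tuple.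
apply: asym_le_mono (asym_wit_peel hp).
rewrite (sum_tuple_cons (fun kap => offspring_weight (map val kap) * x (map val kap))).
have Q1 : Q K <= 1 by exact: poisson_partial_sum_le1.
have Q0 : 0 <= Q K by apply: sumr_ge0 => t _; exact: poisson_pmf_ge0.
have Qk1 : Q K ^+ k <= 1 by exact: exprn_ile1.
apply: (@le_trans _ _ (\sum_(t < K.+1) (\sum_(kap : k.-tuple 'I_K.+1)
   offspring_weight (map val (t :: kap)) * x (map val (t :: kap))
   + pois t * ((1 - Q K ^+ k) * l1norm (k + e).+1 c)) +
   (1 - Q K) * l1norm (k + e).+1 c)).
  rewrite lerD2r; apply: ler_sum => t _; rewrite mulrDr; apply: lerD.
    rewrite mulr_sumr le_eqVlt; apply/orP; left; apply/eqP.
    by apply: eq_bigr => kap _; rewrite /offspring_weight /= big_cons mulrA.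
  apply: ler_wpM2l; first exact: poisson_pmf_ge0.
  apply: ler_wpM2l; first by rewrite subr_ge0.
  by rewrite addnA; exact: l1norm_branch.
rewrite big_split /= -mulr_suml -addrA lerD2l exprS; lra.
Qed.

(** A shape lists the offspring numbers of a forest generation by generation.
    These are all shapes of [r] generations that start from [k] vertices and
    have at most [K] children per vertex. *)
Fixpoint shapes K r k : seq (seq (seq nat)) :=
  if r is r'.+1 then
    flatten [seq [seq map val kap :: s | s <- shapes K r' (sumn (map val kap))]
            | kap : k.-tuple 'I_K.+1]
  else [:: [::]].

Definition shape_weight (s : seq (seq nat)) : R :=
  \prod_(kap <- s) offspring_weight kap.

(** What the labels of the last generation of a forest of a given shape still
    reveal, when the first generation has signed density [c]. *)
Fixpoint shape_norm (s : seq (seq nat)) k c : R :=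
  if s is kap :: s' then shape_norm s' (sumn kap) (branches M kap 0 c)
  else l1norm k c.

Lemma big_shapes K r k (F : seq (seq nat) -> R) :
  \sum_(s <- shapes K r.+1 k) F s =
  \sum_(kap : k.-tuple 'I_K.+1) \sum_(s <- shapes K r (sumn (map val kap)))
    F (map val kap :: s).
Proof.
rewrite /= big_flatten /= big_image /=.
by apply: eq_bigr => kap _; rewrite big_map.
Qed.

Lemma sum_shape_weight_le1 K r k : \sum_(s <- shapes K r k) shape_weight s <= 1.
Proof.
elim: r k => [|r IH] k; first by rewrite big_seq1 /shape_weight big_nil.
rewrite big_shapes; apply: (@le_trans _ _ (Q K ^+ k)); last first.
  apply: exprn_ile1; last exact: poisson_partial_sum_le1.
  by apply: sumr_ge0 => t _; exact: poisson_pmf_ge0.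
rewrite -sum_offspring_weight; apply: ler_sum => kap _.
rewrite /shape_weight; under eq_bigr do rewrite big_cons.
rewrite -mulr_sumr ler_piMr //.
by apply: prodr_ge0 => t _; exact: poisson_pmf_ge0.
Qed.

(** Forests that leave the range of [shapes] have the missing weight; on them
    nothing better than the initial norm is claimed, which suffices because
    every further generation only contracts the norm. *)
Lemma asym_wit_shapes K r k c : asym_wit k c
  (\sum_(s <- shapes K r k) shape_weight s * shape_norm s k c +
   (1 - \sum_(s <- shapes K r k) shape_weight s) * l1norm k c).
Proof.
elim: r k c => [|r IH] k c.
  rewrite !big_seq1 /shape_weight big_nil mul1r subrr mul0r addr0 /=.
  rewrite /asym_wit -l1norm_witness; exact: asym_le_l1norm.
pose x kap := \sum_(s <- shapes K r (sumn kap)) shape_weight s *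
    shape_norm s (sumn kap) (branches M kap 0 c) +
   (1 - \sum_(s <- shapes K r (sumn kap)) shape_weight s) *
    l1norm (sumn kap) (branches M kap 0 c).
have := @asym_wit_level K k 0 c x (fun kap => IH _ _).
rewrite addn0; apply: asym_le_mono.
rewrite !big_shapes -sum_offspring_weight.
set S1 := \sum_(kap : k.-tuple 'I_K.+1) _.
set W := \sum_(kap : k.-tuple 'I_K.+1) offspring_weight _.
set S2 := \sum_(kap : k.-tuple 'I_K.+1) _.
set S := \sum_(kap : k.-tuple 'I_K.+1) _.
suff main : S <= S1 + (W - S2) * l1norm k c by lra.
rewrite -sumrB mulr_suml -big_split /=.
apply: ler_sum => kap _.
rewrite /x mulrDr mulr_sumr; apply: lerD.
  rewrite le_eqVlt; apply/orP; left; apply/eqP; apply: eq_bigr => s _.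
  by rewrite /shape_weight big_cons mulrA.
under [X in _ <= (_ - X) * _]eq_bigr do rewrite /shape_weight big_cons.
rewrite -mulr_sumr -[X in _ <= (X - _) * _]mulr1 -mulrBr mulrA; apply: ler_wpM2l.
  rewrite mulr_ge0 ?subr_ge0 ?sum_shape_weight_le1 //.
  by apply: prodr_ge0 => t _; exact: poisson_pmf_ge0.
have := l1norm_branches M_ge0 M_sum (map val kap) 0 c.
by rewrite add0n addn0 size_map size_tuple.
Qed.

End Witness.

(** * The broadcast process on a fixed tree *)

Section TreeLevels.
Implicit Types (c : tree) (u : seq nat).

Lemma levelS c n : level c n.+1 = flatten [seq children c u | u <- level c n].
Proof. by []. Qed.

Lemma ballS c n : Defs.ball c n.+1 = Defs.ball c n ++ level c n.+1.
Proof.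
by rewrite /Defs.ball -(addn1 n.+1) iotaD add0n map_cat flatten_cat /= cats0.
Qed.

Lemma size_level c n u : u \in level c n -> size u = n.
Proof.
elim: n u => [|n IH] u; first by rewrite inE => /eqP ->.
move=> /flatten_mapP[v /IH sv] /mapP[k _ ->].
by rewrite size_rcons sv.
Qed.

Lemma uniq_children c u : uniq (children c u).
Proof. by rewrite map_inj_uniq ?iota_uniq // => k k' /rcons_inj[]. Qed.

Lemma children_disjoint c u u' v :
  v \in children c u -> v \in children c u' -> u = u'.
Proof. by move=> /mapP[k _ ->] /mapP[k' _ /rcons_inj[]]. Qed.

Lemma uniq_level c n : uniq (level c n).
Proof.
elim: n => [//|n IH]; rewrite levelS.
elim: (level c n) IH => [//|u l IH] /= /andP[ul uql].
rewrite cat_uniq uniq_children IH // andbT.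
apply/hasPn => v /flatten_mapP[u' u'l vu']; apply/negP => vu.
by move: ul; rewrite (children_disjoint vu vu') u'l.
Qed.

Lemma mem_ball c n u : (u \in Defs.ball c n) = (size u <= n)%N && (u \in level c (size u)).
Proof.
apply/flatten_mapP/andP => [[m mn um]|[un ul]].
  by rewrite (size_level um) um -ltnS; move: mn; rewrite mem_iota.
by exists (size u) => //; rewrite mem_iota.
Qed.

Lemma uniq_ball c n : uniq (Defs.ball c n).
Proof.
elim: n => [//|n IH]; rewrite ballS cat_uniq IH uniq_level andbT.
by apply/hasPn => u /size_level su; rewrite mem_ball su ltnn.
Qed.

Lemma root_in_ball c n : [::] \in Defs.ball c n.
Proof. by rewrite mem_ball inE. Qed.

Lemma level_sub_ball c m n : (m <= n)%N -> {subset level c m <= Defs.ball c n}.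
Proof. by move=> mn u um; rewrite mem_ball (size_level um) mn. Qed.

Lemma size_levelS c n : size (level c n.+1) = sumn [seq c u | u <- level c n].
Proof.
rewrite levelS size_flatten /shape -map_comp; congr sumn.
by apply: eq_map => u /=; rewrite /children size_map size_iota.
Qed.

End TreeLevels.

Section SeqSub.
Context (T : choiceType) (B : seq T).

Lemma perm_enum_seq_sub : uniq B -> perm_eq [seq val u | u <- enum {: seq_sub B}] B.
Proof.
move=> uB; apply: uniq_perm => //.
  by rewrite map_inj_uniq ?enum_uniq //; exact: val_inj.
move=> u; apply/mapP/idP => [[v _ ->]|uB']; first exact: valP.
by exists (SeqSub uB'); rewrite ?mem_enum.
Qed.

Lemma big_seq_sub_val (V : Type) (idx : V) (op : Monoid.com_law idx)
    (P : pred T) (f : T -> V) : uniq B ->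
  \big[op/idx]_(u : seq_sub B | P (val u)) f (val u) = \big[op/idx]_(u <- B | P u) f u.
Proof.
move=> uB; rewrite -(perm_big _ (perm_enum_seq_sub uB)) /= big_map.
by rewrite big_enum_cond.
Qed.

(** Spin configurations on a duplicate-free list of vertices are lists of spins.
    The summand is given as a function of a total assignment of spins, because
    the vertex sets of balls of different radii are different types. *)
Lemma sum_ffun_seq_sub (V : nmodType) (A : finType) (a0 : A)
    (Phi : (T -> A) -> V) :
  uniq B ->
  (forall f g, {in B, f =1 g} -> Phi f = Phi g) ->
  \sum_(s : {ffun seq_sub B -> A}) Phi (fun u => if insub u is Some v then s v else a0)
  = \sum_(L : (size B).-tuple A) Phi (fun u => nth a0 L (index u B)).
Proof.
move=> uB Phi_ext.
have idxlt (v : seq_sub B) : (index (val v) B < size B)%N by rewrite index_mem (valP v).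
pose to_fun (L : (size B).-tuple A) : {ffun seq_sub B -> A} :=
  [ffun v => nth a0 L (index (val v) B)].
rewrite (reindex to_fun) /=; last first.
  exists (fun s : {ffun seq_sub B -> A} =>
    [tuple of [seq (if insub u is Some v then s v else a0) | u <- in_tuple B]]).
    move=> L _; apply: eq_from_tnth => k; pose u0 := tnth (in_tuple B) k.
    rewrite tnth_map (tnth_nth u0) /=.
    have kB : nth u0 B k \in B by rewrite mem_nth.
    by rewrite (insubT (mem B) kB) ffunE /= index_uniq // (tnth_nth a0).
  move=> s _; apply/ffunP => v; rewrite ffunE.
  rewrite (nth_map (val v)) /= ?idxlt // nth_index ?(valP v) //.
  by rewrite valK.
apply: eq_bigr => L _; apply: Phi_ext => u uB'.
by rewrite (insubT (mem B) uB') ffunE.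
Qed.

End SeqSub.

Section Broadcast.
Context (R : realType) (q : nat) (lam : R) (c : tree).
Local Notation M := (@transition R q lam).
Hypothesis M_sum : forall l, \sum_x M l x = 1.

Definition tree_weight (n : nat) (sg : seq nat -> 'I_q) : R :=
  \prod_(m < n) \prod_(u <- level c m) \prod_(v <- children c u) M (sg u) (sg v).

(** The vertices of the last generation have their children outside the ball. *)
Lemma prod_children_in_ball n u (f : seq nat -> R) : u \in Defs.ball c n ->
  \prod_(v <- Defs.ball c n | v \in children c u) f v =
  if (size u < n)%N then \prod_(v <- children c u) f v else 1.
Proof.
rewrite mem_ball => /andP[un ul]; case: ifPn => [ltun|]; last first.
  rewrite -leqNgt => nu; rewrite big_seq_cond big1 // => v /andP[].
  rewrite mem_ball => /andP[vn _] /mapP[k _ ev].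
  by move: vn; rewrite ev size_rcons ltnNge nu.
rewrite -big_filter; apply: perm_big; apply: uniq_perm.
- exact/filter_uniq/uniq_ball.
- exact: uniq_children.
move=> v; rewrite mem_filter andb_idr // => vu.
apply: (level_sub_ball ltun); apply/flatten_mapP; by exists u.
Qed.

(** The default value [i] is only used outside the ball. *)
Definition spin_at n (i : 'I_q) (s : ball_spins c n q) (u : seq nat) : 'I_q :=
  if insub u is Some v then s v else i.

Lemma spin_at_val n i (s : ball_spins c n q) u : spin_at i s (val u) = s u.
Proof. by rewrite /spin_at valK. Qed.

Lemma broadcast_pmfE n i (s : ball_spins c n q) :
  broadcast_pmf lam s = q%:R^-1 * tree_weight n (spin_at i s).
Proof.
congr (_ * _).
transitivity (\prod_(u <- Defs.ball c n) \prod_(v <- Defs.ball c n | v \in children c u)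
    M (spin_at i s u) (spin_at i s v)).
  rewrite -(big_seq_sub_val _ xpredT (fun u => \prod_(v <- Defs.ball c n | v \in children c u)
    M (spin_at i s u) (spin_at i s v)) (uniq_ball c n)).
  under [RHS]eq_bigr => u _.
    rewrite -(big_seq_sub_val _ (fun v => v \in children c (val u))
      (fun v => M (spin_at i s (val u)) (spin_at i s v)) (uniq_ball c n)).
    over.
  rewrite pair_big_dep; apply: eq_bigr => -[u v] _ /=.
  by rewrite !spin_at_val.
rewrite big_seq; under eq_bigr => u uB do rewrite prod_children_in_ball //.
rewrite -big_seq big_flatten big_map -[iota 0 n.+1]/(index_iota 0 n.+1) big_mkord.
rewrite big_ord_recr /= [X in _ * X]big_seq [X in _ * X]big1 ?mulr1; last first.
  by move=> u /size_level ->; rewrite ltnn.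
apply: eq_bigr => m _; apply: eq_big_seq => u /size_level ->.
by rewrite ltn_ord.
Qed.

Lemma level_weight_map (sg : seq nat -> 'I_q) (lv : seq (seq nat)) :
  level_weight M (map sg lv) [seq c u | u <- lv]
    (map sg (flatten [seq children c u | u <- lv])) =
  \prod_(u <- lv) \prod_(v <- children c u) M (sg u) (sg v).
Proof.
rewrite /level_weight; elim: lv => [|u lv IH]; first by rewrite !big_nil.
rewrite /= big_cons map_cat take_size_cat ?drop_size_cat; last 2 first.
- by rewrite size_map /children size_map size_iota.
- by rewrite size_map /children size_map size_iota.
by rewrite big_cons IH big_map.
Qed.

(** The density of the labels of generation [m] when the root has density
    [c0]. *)
Fixpoint tree_state (c0 : seq 'I_q -> R) (m : nat) : seq 'I_q -> R :=
  if m is m'.+1 then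
    branches M [seq c u | u <- level c m'] 0 (tree_state c0 m')
  else c0.

Lemma tree_stateS c0 m (s : seq 'I_q) : size s = size (level c m.+1) ->
  tree_state c0 m.+1 s = \sum_(L : (size (level c m)).-tuple 'I_q)
    tree_state c0 m L * level_weight M L [seq c u | u <- level c m] s.
Proof.
move=> ss; have := @branchesE R _ M [seq c u | u <- level c m] 0 (tree_state c0 m) [::] s.
rewrite size_map /= => -> //; last by rewrite ss size_levelS.
by apply: eq_bigr => L _; rewrite cats0.
Qed.

Definition point_mass (i : 'I_q) (s : seq 'I_q) : R := (s == [:: i])%:R.

Lemma sum_level_weight L kap : size L = size kap ->
  \sum_(s : (sumn kap).-tuple 'I_q) level_weight M L kap s = 1.
Proof.
elim: kap L => [|t kap IH] [|l L] //=.
  by rewrite (sum_tuple0 (fun s => level_weight M [::] [::] s)) /level_weight big_nil.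
move=> [sL]; rewrite (sum_tuple_cat (fun s => level_weight M (l :: L) (t :: kap) s)).
transitivity (\sum_(u : t.-tuple 'I_q) \sum_(v : (sumn kap).-tuple 'I_q)
   (\prod_(x <- u) M l x) * level_weight M L kap v).
  apply: eq_bigr => u _; apply: eq_bigr => v _.
  by rewrite /level_weight /= big_cons take_size_cat ?drop_size_cat ?size_tuple.
under eq_bigr => u _ do rewrite -mulr_sumr IH // mulr1.
by rewrite sum_tuple_prod M_sum expr1n.
Qed.

Lemma sum_tree_state i n :
  \sum_(s : (size (level c n)).-tuple 'I_q) tree_state (point_mass i) n s = 1.
Proof.
elim: n => [|n IH].
  rewrite /= (sum_tuple_cons (fun s => point_mass i s)) (bigD1 i) //=.
  rewrite (sum_tuple0 (fun s => point_mass i (i :: s))) /point_mass eqxx.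
  rewrite big1 ?addr0 // => l li; rewrite (sum_tuple0 (fun s => point_mass i (l :: s))).
  by rewrite /point_mass eqseq_cons (negbTE li).
rewrite -[RHS]IH.
under eq_bigr => s _ do rewrite tree_stateS ?size_tuple //.
rewrite exchange_big; apply: eq_bigr => L _ /=.
rewrite -mulr_sumr size_levelS sum_level_weight ?mulr1 //.
by rewrite size_map size_tuple.
Qed.

Definition list_spin n (i : 'I_q) (L : seq 'I_q) (u : seq nat) : 'I_q :=
  nth i L (index u (Defs.ball c n)).

(** Forward equation of the broadcast process: the ball of radius n + 1 is the
    ball of radius n followed by generation n + 1, and summing over the spins of
    the last generation first replaces [Psi] by its mean given generation n. *)
Lemma sum_list_spin n i (Psi : seq 'I_q -> R) :
  \sum_(L : (size (Defs.ball c n)).-tuple 'I_q)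
     (list_spin n i L [::] == i)%:R * tree_weight n (list_spin n i L) *
     Psi [seq list_spin n i L u | u <- level c n] =
  \sum_(t : (size (level c n)).-tuple 'I_q) tree_state (point_mass i) n t * Psi t.
Proof.
elim: n Psi => [|n IH] Psi.
  apply: eq_bigr => L _; rewrite /tree_weight big_ord0 mulr1 /= /list_spin /=.
  case/tupleP: L => l L; rewrite tuple0 /= /point_mass eqseq_cons eqxx andbT.
  by case: eqP => [->|].
rewrite [in size _]ballS size_cat.
rewrite (sum_tuple_cat (fun L : seq 'I_q => (list_spin n.+1 i L [::] == i)%:R *
  tree_weight n.+1 (list_spin n.+1 i L) * Psi [seq list_spin n.+1 i L u | u <- level c n.+1])).
pose Psi' (t : seq 'I_q) := \sum_(L2 : (size (level c n.+1)).-tuple 'I_q)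
  level_weight M t [seq c u | u <- level c n] L2 * Psi L2.
transitivity (\sum_(t : (size (level c n)).-tuple 'I_q)
    tree_state (point_mass i) n t * Psi' t); last first.
  under [RHS]eq_bigr => s _ do rewrite tree_stateS ?size_tuple // mulr_suml.
  rewrite exchange_big; apply: eq_bigr => L _ /=; rewrite mulr_sumr.
  by apply: eq_bigr => s _; rewrite mulrA.
rewrite -IH; apply: eq_bigr => L1 _; rewrite mulr_sumr; apply: eq_bigr => L2 _.
have look1 u : u \in Defs.ball c n -> list_spin n.+1 i (L1 ++ L2) u = list_spin n i L1 u.
  move=> uB; rewrite /list_spin ballS index_cat uB nth_cat size_tuple.
  by rewrite index_mem uB.
have look2 : [seq list_spin n.+1 i (L1 ++ L2) u | u <- level c n.+1] = L2.
  apply: (@eq_from_nth _ i); first by rewrite size_map size_tuple.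
  move=> k; rewrite size_map => kl; rewrite (nth_map [::]) // /list_spin ballS index_cat.
  have /negbTE -> : nth [::] (level c n.+1) k \notin Defs.ball c n.
    by rewrite mem_ball (size_level (mem_nth _ kl)) ltnn.
  rewrite index_uniq ?uniq_level // nth_cat size_tuple ltnNge leq_addr /=.
  by rewrite addKn.
rewrite look2 look1 ?root_in_ball //.
rewrite [RHS]mulrA; congr (_ * _); rewrite -mulrA; congr (_ * _).
rewrite /tree_weight big_ord_recr /=; congr (_ * _).
  apply: eq_bigr => m _; apply: eq_big_seq => u um; apply: eq_big_seq => v vu.
  have uB := level_sub_ball (ltnW (ltn_ord m)) um.
  have vB : v \in Defs.ball c n.
    by apply: (level_sub_ball (ltn_ord m)); apply/flatten_mapP; exists u.
  by rewrite !look1.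
rewrite -level_weight_map [X in level_weight M _ _ X = _](_ : _ = tval L2); last exact: look2.
congr (level_weight M _ _ _).
by apply/eq_in_map => u un; apply/look1/(level_sub_ball (leqnn n)).
Qed.

Lemma sum_broadcast n i (Psi : seq 'I_q -> R) :
  \sum_(s : ball_spins c n q | root_is i s)
     broadcast_pmf lam s * Psi [seq spin_at i s u | u <- level c n] =
  q%:R^-1 * \sum_(t : (size (level c n)).-tuple 'I_q)
    tree_state (point_mass i) n t * Psi t.
Proof.
rewrite -sum_list_spin mulr_sumr big_mkcond /=.
pose Phi sg := q%:R^-1 * ((sg [::] == i)%:R * tree_weight n sg *
   Psi [seq sg u | u <- level c n]).
rewrite -(sum_ffun_seq_sub (Phi := Phi) i (uniq_ball c n)); last first.
  move=> f g fg; rewrite /Phi fg ?root_in_ball //; congr (_ * (_ * _ * _)).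
    apply: eq_bigr => m _; apply: eq_big_seq => u um; apply: eq_big_seq => v vu.
    have uB := level_sub_ball (ltnW (ltn_ord m)) um.
    have vB : v \in Defs.ball c n.
      by apply: (level_sub_ball (ltn_ord m)); apply/flatten_mapP; exists u.
    by rewrite !fg.
  congr Psi; apply/eq_in_map => u un.
  exact/fg/(level_sub_ball (leqnn n)).
apply: eq_bigr => s _; rewrite /Phi -/(spin_at i s).
have -> : root_is i s = (spin_at i s [::] == i).
  apply/forallP/eqP => [h|h u].
    have := h (SeqSub (root_in_ball c n)); rewrite -(spin_at_val i) eqxx /= => /eqP.
    exact.
  by apply/implyP => /eqP u0; rewrite -(spin_at_val i) u0 h.
case: eqP => _; last by rewrite !mul0r mulr0.
by rewrite mul1r mulrA -(broadcast_pmfE i).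
Qed.

(** Conditioning on the root means dividing by 1/q, which cancels the uniform
    weight of the root in the joint law. *)
Lemma level_lawE n (i : 'I_q) (t : level_spins c n q) :
  level_law lam i t =
  tree_state (point_mass i) n [seq (if insub u is Some v then t v else i) | u <- level c n].
Proof.
have q0 : q%:R != 0 :> R by rewrite pnatr_eq0 -lt0n (leq_ltn_trans _ (ltn_ord i)).
have den : broadcast_prob lam (@root_is c n q i) = q%:R^-1.
  transitivity (\sum_(s : ball_spins c n q | root_is i s) broadcast_pmf lam s * 1).
    by apply: eq_bigr => s _; rewrite mulr1.
  rewrite (sum_broadcast n i (fun=> 1)) -[RHS]mulr1 -[X in _ = _ * X](sum_tree_state i n).
  by congr (_ * _); apply: eq_bigr => s _; rewrite mulr1.
set tl := map _ _.
have num : broadcast_prob lam (fun s => root_is i s && level_is t s) =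
   q%:R^-1 * tree_state (point_mass i) n tl.
  have := sum_broadcast n i (fun s => (s == tl)%:R).
  have szt : size tl == size (level c n) by rewrite size_map.
  rewrite [in RHS](bigD1 (Tuple szt)) //= eqxx mulr1 [X in _ + X]big1 ?addr0; last first.
    by move=> s; rewrite -val_eqE /= => /negPf ->; rewrite mulr0.
  move=> <-; rewrite /broadcast_prob big_mkcondr /=; apply: eq_bigr => s _.
  suff -> : level_is t s = ([seq spin_at i s u | u <- level c n] == tl).
    by case: ifP => _; rewrite ?mulr1 ?mulr0.
  apply/forallP/eqP => [h|/eq_in_map h u].
    apply/eq_in_map => u un.
    have uB := level_sub_ball (leqnn n) un.
    have /forallP/(_ (SeqSub un))/implyP/(_ (eqxx _))/eqP e := h (SeqSub uB).
    by rewrite insubT /= -e -(spin_at_val i).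
  apply/forallP => v; apply/implyP => /eqP uv.
  rewrite -(spin_at_val i) uv h ?(valP v) //.
  by rewrite valK eqxx.
by rewrite /level_law num den mulrAC mulfV ?mul1r // invr_neq0.
Qed.

Lemma sum_level_spins n (i : 'I_q) (Psi : seq 'I_q -> R) :
  \sum_(t : level_spins c n q)
    Psi [seq (if insub u is Some v then t v else i) | u <- level c n] =
  \sum_(s : (size (level c n)).-tuple 'I_q) Psi s.
Proof.
rewrite (sum_ffun_seq_sub (Phi := fun sg => Psi [seq sg u | u <- level c n]) i
  (uniq_level c n)); last first.
  by move=> f g fg; congr Psi; apply/eq_in_map.
apply: eq_bigr => s _; congr Psi; apply: (@eq_from_nth _ i).
  by rewrite size_map size_tuple.
move=> k; rewrite size_map => kl.
by rewrite (nth_map [::]) // index_uniq ?uniq_level.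
Qed.

Definition root_contrast (i j : 'I_q) (s : seq 'I_q) : R :=
  point_mass i s - point_mass j s.

Lemma tree_state_contrast i j n (s : seq 'I_q) : size s = size (level c n) ->
  tree_state (root_contrast i j) n s =
  tree_state (point_mass i) n s - tree_state (point_mass j) n s.
Proof.
elim: n s => [//|n IH] s ss; rewrite !tree_stateS // -sumrB.
by apply: eq_bigr => L _; rewrite IH ?size_tuple // mulrBl.
Qed.

Lemma dTV_level_law n (i j : 'I_q) :
  dTV (@level_law R c n q lam i) (@level_law R c n q lam j) =
  2^-1 * l1norm (size (level c n)) (tree_state (root_contrast i j) n).
Proof.
congr (_ * _); rewrite /l1norm -(sum_level_spins n i (fun s => `|tree_state (root_contrast i j) n s|)).
apply: eq_bigr => t _; rewrite tree_state_contrast ?size_map // !level_lawE.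
congr (`|_ - tree_state _ _ _|); apply/eq_in_map => u un.
by rewrite insubT.
Qed.

End Broadcast.

(** * The shape of the Galton-Watson tree *)

Section Shapes.
Implicit Types (c : tree) (s : seq (seq nat)).

Definition tree_shape c (r : nat) : seq (seq nat) :=
  [seq [seq c u | u <- level c m] | m <- iota 0 r].

Definition inner_vertices c (r : nat) : seq (seq nat) :=
  flatten [seq level c m | m <- iota 0 r].

Lemma tree_shapeS c r : tree_shape c r.+1 = rcons (tree_shape c r) [seq c u | u <- level c r].
Proof. by rewrite /tree_shape -(addn1 r) iotaD map_cat /= cats1. Qed.

Lemma innerS c r : inner_vertices c r.+1 = inner_vertices c r ++ level c r.
Proof. by rewrite /inner_vertices -(addn1 r) iotaD map_cat flatten_cat /= cats0. Qed.

Lemma uniq_inner c r : uniq (inner_vertices c r).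
Proof. by case: r => [//|r]; exact: uniq_ball. Qed.

Lemma size_inner c r u : u \in inner_vertices c r -> (size u < r)%N.
Proof. by case: r => [//|r]; rewrite [_ \in _]mem_ball => /andP[]. Qed.

Lemma eq_level c c' r : {in inner_vertices c r, c =1 c'} -> level c r = level c' r.
Proof.
elim: r => [//|r IH] cc'; rewrite !levelS -IH; last first.
  by move=> u ur; apply: cc'; rewrite innerS mem_cat ur.
congr flatten; apply/eq_in_map => u ur; congr map.
by rewrite /children cc' // innerS mem_cat ur orbT.
Qed.

(** A shape determines the offspring numbers of all vertices before generation
    [r]: generation by generation, it first determines which vertices exist. *)
Lemma tree_shape_eqP c c' r : tree_shape c r = tree_shape c' r <-> {in inner_vertices c r, c =1 c'}.
Proof.
elim: r => [//|r [IH1 IH2]]; rewrite !tree_shapeS innerS; split.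
  move/rcons_inj => [/IH1 cc' e] u; rewrite mem_cat => /orP[/cc'//|ur].
  by move: e; rewrite -(eq_level cc') => /eq_in_map; exact.
move=> cc'.
have cc1 : {in inner_vertices c r, c =1 c'}.
  by move=> u ur; apply: cc'; rewrite mem_cat ur.
rewrite (IH2 cc1) -(eq_level cc1); congr rcons; apply/eq_in_map => u ur.
by apply: cc'; rewrite mem_cat ur orbT.
Qed.

Lemma last_tree_shape c r : last 1%N (map sumn (tree_shape c r)) = size (level c r).
Proof.
by case: r => [//|r]; rewrite tree_shapeS map_rcons last_rcons -size_levelS.
Qed.

Fixpoint valid_shape k s : bool :=
  if s is kap :: s' then (size kap == k) && valid_shape (sumn kap) s' else true.

Lemma valid_shape_rcons k s kap :
  valid_shape k (rcons s kap) =
  valid_shape k s && (size kap == last k (map sumn s)).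
Proof. by elim: s k => [|kap' s IH] k /=; rewrite ?andbT // IH andbA. Qed.

Lemma valid_tree_shape c r : valid_shape 1 (tree_shape c r).
Proof.
elim: r => [//|r IH].
by rewrite tree_shapeS valid_shape_rcons IH last_tree_shape size_map eqxx.
Qed.

(** Built from the top: the offspring numbers of a new last generation can be
    prescribed freely, since they do not affect the earlier generations. *)
Lemma valid_shape_realized s : valid_shape 1 s -> exists c, tree_shape c (size s) = s.
Proof.
elim/last_ind: s => [|s kap IH]; first by exists (fun=> 0%N).
rewrite valid_shape_rcons => /andP[/IH[c cs]].
rewrite -{1}cs last_tree_shape => /eqP sk.
set r := size s in cs sk.
pose c' u := if u \in level c r then nth 0%N kap (index u (level c r)) else c u.
have cc' : {in inner_vertices c r, c =1 c'}.
  move=> u /size_inner ur; rewrite /c' ifN //; apply/negP => /size_level e.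
  by rewrite e ltnn in ur.
exists c'; rewrite size_rcons tree_shapeS -(eq_level cc').
have/tree_shape_eqP <- := cc'; rewrite cs; congr rcons.
apply: (@eq_from_nth _ 0%N); first by rewrite size_map.
move=> k; rewrite size_map => kr; rewrite (nth_map [::]) // /c' mem_nth //.
by rewrite index_uniq // uniq_level.
Qed.

Lemma bounded_tuple K k (kap : seq nat) : size kap = k -> all (leq^~ K) kap ->
  exists t : k.-tuple 'I_K.+1, map val t = kap.
Proof.
move=> sk kK.
have st : size (map (@inord K) kap) == k by rewrite size_map sk.
exists (Tuple st); rewrite /= -map_comp -[RHS]map_id; apply/eq_in_map => u uk /=.
by rewrite inordK // ltnS; exact: (allP kK).
Qed.

Lemma mem_shapes K r k s :
  (s \in shapes K r k) = [&& size s == r, valid_shape k s & all (all (leq^~ K)) s].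
Proof.
elim: r k s => [|r IH] k s /=; first by case: s.
apply/flatten_imageP/and3P => [[t _ /mapP[s' s's ->]]|].
  move: s's; rewrite IH => /and3P[/eqP <- vs' bs'].
  split; rewrite //= ?size_map ?size_tuple ?eqxx ?bs' ?andbT //.
  by apply/allP => _ /mapP[i _ ->]; rewrite -ltnS.
case: s => [[]//|kap s] /= [ss /andP[/eqP sk vs] /andP[bk bs]].
have [t et] := bounded_tuple sk bk.
by exists t => //; apply/mapP; exists s; rewrite ?IH et // bs vs -eqSS ss.
Qed.

Lemma uniq_shapes K r k : uniq (shapes K r k).
Proof.
elim: r k => [//|r IH] k /=.
suff H (l : seq (k.-tuple 'I_K.+1)) : uniq l -> uniq (flatten
    [seq [seq map val (tval kap) :: s | s <- shapes K r (sumn (map val (tval kap)))]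
    | kap <- l]).
  exact: H (enum_uniq _).
elim: l => [//|t l IHl] /= /andP[tl ul].
rewrite cat_uniq map_inj_uniq ?IH ?IHl ?andbT /=; [|exact: ul|by move=> ? ? []].
apply/hasPn => s /flatten_mapP[t' t'l /mapP[s' _ ->]].
apply/negP => /mapP[s'' _ [/(inj_map val_inj)/val_inj tt' _]].
by move: tl; rewrite -tt' t'l.
Qed.

End Shapes.

Lemma shape_norm_tree_shape (R : realType) (q : nat) (lam : R) (c : tree)
    (c0 : seq 'I_q -> R) r :
  shape_norm (@transition R q lam) (tree_shape c r) 1 c0 =
  l1norm (size (level c r)) (tree_state lam c c0 r).
Proof.
suff H m : shape_norm (@transition R q lam)
    [seq [seq c u | u <- level c m'] | m' <- iota m r] (size (level c m))
      (tree_state lam c c0 m) =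
    l1norm (size (level c (m + r))) (tree_state lam c c0 (m + r)) by exact: (H 0%N).
elim: r m => [|r IH] m; first by rewrite addn0.
by rewrite /= -size_levelS addnS -addSn -IH.
Qed.

Section ProbabilityFacts.
Context (R : realType) (disp : measure_display) (Omega : measurableType disp).
Context (P : probability Omega R).

Lemma measurable_countable_preimage (T : countType) (X : Omega -> T) (Q : T -> Prop) :
  (forall s, measurable [set w | X w = s]) -> measurable [set w | Q (X w)].
Proof.
move=> mX.
rewrite (_ : [set w | Q (X w)] = \bigcup_n
  [set w | Q (X w) /\ pickle (X w) = n]); last first.
  by apply/seteqP; split => [w Qw|w [n _ []]//]; exists (pickle (X w)).
apply: bigcupT_measurable => n.
case: (pselect (exists s : T, Q s /\ pickle s = n)) => [[s [Qs sn]]|h].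
  rewrite (_ : [set w | _] = [set w | X w = s]) //.
  apply/seteqP; split => w /=; last by move=> ->.
  by move=> [_ e]; apply: (pcan_inj pickleK); rewrite e sn.
rewrite (_ : [set w | _] = set0) //; apply/seteqP; split => w //= [Qw e].
by apply: h; exists (X w).
Qed.

Lemma sum_prob_fiber (T : countType) (X : Omega -> T) (l : seq T) :
  (forall s, measurable [set w | X w = s]) -> uniq l ->
  (\sum_(s <- l) P [set w | X w = s] = P [set w | X w \in l])%E.
Proof.
move=> mX; elim: l => [|s l IH] /=.
  move=> _; rewrite big_nil; rewrite (_ : [set w | _] = set0) ?measure0 //.
  by apply/seteqP; split.
move=> /andP[sl ul]; rewrite big_cons IH //.
rewrite (_ : [set w | X w \in s :: l] = [set w | X w = s] `|` [set w | X w \in l]).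
  rewrite measureU //; first exact: measurable_countable_preimage (fun x => x \in l) mX.
  by apply/seteqP; split => w //= [-> h]; rewrite h in sl.
apply/seteqP; split => w /=; rewrite inE.
  by move=> /orP[/eqP|]; [left|right].
by case=> [->|->]; rewrite ?eqxx ?orbT.
Qed.

End ProbabilityFacts.

Lemma shape_norm_le (R : realType) (A : finType) (M : A -> A -> R) s k c :
  (forall l x, 0 <= M l x) -> (forall l, \sum_x M l x = 1) ->
  valid_shape k s -> shape_norm M s k c <= l1norm k c.
Proof.
move=> M0 M1; elim: s k c => [//|kap s IH] k c /= /andP[/eqP sk vs].
apply: le_trans (IH _ _ vs) _.
by have := l1norm_branches M0 M1 kap 0 c; rewrite add0n addn0 sk.
Qed.

Definition gw_tree (R : realType) (disp : measure_display)
    (Omega : measurableType disp) (P : probability Omega R)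
    (xi : seq nat -> {RV P >-> nat}) (w : Omega) : tree :=
  fun u => xi u w.

Section GaltonWatson.
Context (R : realType) (d : R) (disp : measure_display).
Context (Omega : measurableType disp) (P : probability Omega R).
Context (xi : seq nat -> {RV P >-> nat}).
Hypothesis hGW : poisson_galton_watson d xi.

Local Notation tr := (gw_tree xi).

(** Fixing the shape fixes finitely many offspring variables, although which
    ones depends on the shape itself. *)
Lemma shape_cylinder c r : [set w | tree_shape (tr w) r = tree_shape c r] =
  \bigcap_(u in [set` inner_vertices c r]) (xi u @^-1` [set c u]).
Proof.
apply/seteqP; split => w /=.
  by move=> /esym/tree_shape_eqP h u /= ui; exact/esym/h.
by move=> h; apply/esym/tree_shape_eqP => u ui; rewrite /gw_tree (h u ui).
Qed.

Lemma measurable_shape r s : measurable [set w | tree_shape (tr w) r = s].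
Proof.
case: (pselect (exists w0, tree_shape (tr w0) r = s)) => [[w0 <-]|h].
  rewrite shape_cylinder; apply: fin_bigcap_measurable; first exact: finite_seq.
  by move=> u _; apply: measurable_funPTI.
rewrite (_ : [set w | _] = set0) //; apply/seteqP; split => w //= e.
by apply: h; exists w.
Qed.

Lemma prob_shape c r :
  P [set w | tree_shape (tr w) r = tree_shape c r] = (shape_weight d (tree_shape c r))%:E.
Proof.
rewrite shape_cylinder; have [indep law] := hGW.
rewrite (indep _ (fun u => [set c u])) ?uniq_inner //.
rewrite (eq_bigr (fun u => (poisson_pmf d (c u))%:E)); last by move=> u _; rewrite law.
rewrite prodEFin; congr (_%:E).
rewrite /inner_vertices /tree_shape big_flatten big_map /shape_weight big_map.
by apply: eq_bigr => m _; rewrite /offspring_weight big_map.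
Qed.

Lemma prob_valid_shape r s : size s = r -> valid_shape 1 s ->
  P [set w | tree_shape (tr w) r = s] = (shape_weight d s)%:E.
Proof. by move=> <- /valid_shape_realized[c cs]; rewrite -{2 3}cs prob_shape cs. Qed.

Lemma sum_shapes_prob K r (Q : pred (seq (seq nat))) :
  (\sum_(s <- shapes K r 1 | Q s) shape_weight d s)%:E =
  P [set w | tree_shape (tr w) r \in [seq s <- shapes K r 1 | Q s]].
Proof.
rewrite -sum_prob_fiber; first last.
- exact/filter_uniq/uniq_shapes.
- exact: measurable_shape.
rewrite big_filter -sumEFin big_seq_cond [RHS]big_seq_cond.
apply: eq_bigr => s /andP[]; rewrite mem_shapes => /and3P[/eqP sr vs _] _.
by rewrite prob_valid_shape.
Qed.

(** The first [r] generations are finite, so their offspring numbers are bounded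
    by some [K]; conclude by continuity of the probability from below. *)
Lemma cvg_sum_shapes r :
  \sum_(s <- shapes K r 1) shape_weight d s @[K --> \oo] --> (1 : R).
Proof.
suff : (\sum_(s <- shapes K r 1) shape_weight d s)%:E @[K --> \oo] --> (1%:E : \bar R).
  by move=> /fine_cvgP[].
pose B K := [set w | tree_shape (tr w) r \in shapes K r 1].
have mB K : measurable (B K).
  exact: (measurable_countable_preimage (fun s => s \in shapes K r 1) (measurable_shape r)).
have BU : \bigcup_K B K = setT.
  apply/seteqP; split => // w _.
  (* The total number of vertices bounds each offspring number. *)
  exists (sumn (map sumn (tree_shape (tr w) r))) => //.
  rewrite /B /= mem_shapes size_map size_iota eqxx valid_tree_shape /=.
  have le_sumn (l : seq nat) x : x \in l -> (x <= sumn l)%N.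
    by elim: l => [//|y l IH]; rewrite inE => /orP[/eqP ->|/IH h] /=; lia.
  apply/allP => kap ks; apply/allP => x xk.
  apply: leq_trans (le_sumn _ _ xk) _; apply: le_sumn.
  by apply/mapP; exists kap.
have ndB : nondecreasing_seq B.
  move=> K K' KK'; apply/subsetPset => w; rewrite /B /= !mem_shapes.
  move=> /and3P[-> -> h]; rewrite /=; apply: sub_all h => kap.
  by apply: sub_all => x /leq_trans; apply.
have mBU : measurable (\bigcup_K B K) by rewrite BU.
have PB : P (B K) @[K --> \oo] --> P setT.
  by rewrite -BU; exact: nondecreasing_cvg_mu.
rewrite probability_setT in PB; apply: cvg_trans PB; apply: near_eq_cvg.
near=> K => /=; rewrite /B.
have := sum_shapes_prob K r xpredT; rewrite filter_predT.
by move=> <-.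
Unshelve. all: by end_near. Qed.

End GaltonWatson.

Section NonreconstructionBound.
Context (R : realType) (q : nat) (lam d : R) (disp : measure_display).
Context (Omega : measurableType disp) (P : probability Omega R).
Context (xi : seq nat -> {RV P >-> nat}).
Hypothesis hGW : poisson_galton_watson d xi.
Hypothesis d_gt0 : 0 < d.
Local Notation M := (@transition R q lam).
Hypothesis M_ge0 : forall l x, 0 <= M l x.
Hypothesis M_sum : forall l, \sum_x M l x = 1.
Hypothesis hnonrec : {ae P, forall w, nonreconstruction q lam (fun u => xi u w)}.
Variables i j : 'I_q.

Local Notation tr := (gw_tree xi).
Local Notation N s := (shape_norm M s 1 (root_contrast R i j)).

Lemma dTV_shape r w : dTV (@level_law R (tr w) r q lam i) (@level_law R (tr w) r q lam j)
  = 2^-1 * N (tree_shape (tr w) r).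
Proof. by rewrite dTV_level_law // shape_norm_tree_shape. Qed.

Lemma l1norm_root_contrast : l1norm 1 (root_contrast R i j) <= 2.
Proof.
have H (k : 'I_q) : \sum_(s : 1.-tuple 'I_q) `|point_mass R k s| = 1.
  have := @sum_tree_state R q lam (fun=> 0%N) M_sum k 0.
  by rewrite /= => <-; apply: eq_bigr => s _; rewrite ger0_norm // ler0n.
rewrite -[2](_ : 1 + 1 = 2) // -{1}(H i) -(H j) -big_split /=.
by apply: ler_sum => s _; exact: ler_normB.
Qed.

Lemma measurable_N r (Q : R -> Prop) : measurable [set w | Q (N (tree_shape (tr w) r))].
Proof.
exact: (measurable_countable_preimage (fun s => Q (N s)) (measurable_shape xi r)).
Qed.

(** Almost sure convergence to 0 implies convergence in probability.  The events
    are measurable because the norm is a function of the shape, a countable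
    datum. *)
Lemma rare_reconstruction (e : R) : 0 < e ->
  exists r, (P [set w | (e < N (tree_shape (tr w) r))%R] <= e%:E)%E.
Proof.
move=> e0.
(* Some generation from n on is above the threshold. *)
pose F n := \bigcup_(r in [set r | (n <= r)%N]) [set w | e < N (tree_shape (tr w) r)].
have mF n : measurable (F n).
  by apply: bigcup_measurable => r _; exact: (measurable_N r (fun x => e < x)).
have mcap : measurable (\bigcap_n F n) by exact: bigcap_measurableType.
have cap0 : P (\bigcap_n F n) = 0%E.
  have [Z [mZ PZ subZ]] := hnonrec.
  apply/eqP; rewrite eq_le measure_ge0 andbT -PZ le_measure ?inE //.
  move=> w Fw; apply: subZ => /= nr.
  have := nr i j; under eq_fun do rewrite dTV_shape.
  move=> lim0.
  have /fine_cvgP[_ /= cv] : ((2^-1 * N (tree_shape (tr w) n))%:E @[n --> \oo] --> (0%:E : \bar R)).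
    apply: limn_esup_le_cvg; first by rewrite lim0.
    move=> n; rewrite lee_fin mulr_ge0 // shape_norm_tree_shape.
    exact: sumr_ge0.
  have e2 : 0 < e / 2 by rewrite divr_gt0.
  have /cvgr_lt/(_ _ e2)[m _ hm] := cv.
  have [r mr /=] := Fw m I.
  have := hm r mr; rewrite /= => h1 h2.
  lra.
have noninc : nonincreasing_seq F.
  move=> m n mn; apply/subsetPset => w [r nr h]; exists r => //=.
  exact: leq_trans mn nr.
have PF : P (F n) @[n --> \oo] --> (0%E : \bar R).
  rewrite -cap0; apply: nonincreasing_cvg_mu => //.
  by rewrite (le_lt_trans (probability_le1 _ _)) // ltry.
have /fine_cvgP[ff /cvgr_le/(_ _ e0) h] := PF.
near \oo => n.
exists n; apply: (@le_trans _ _ (P (F n))).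
  rewrite le_measure ?inE //; first exact: (measurable_N n (fun x => e < x)).
  by move=> w h'; exists n => //=.
have -> : P (F n) = (fine (P (F n)))%:E.
  by rewrite fineK //; near: n.
by rewrite lee_fin; near: n.
Unshelve. all: by end_near. Qed.

(** The shapes on which the norm exceeds the threshold have small total weight by
    [rare_reconstruction]; the norm is at most 2 on them.  Then K is chosen,
    depending on r, to exhaust the mass. *)
Lemma shapes_bound (e : R) : 0 < e -> exists r K,
  \sum_(s <- shapes K r 1) shape_weight d s * N s +
  (1 - \sum_(s <- shapes K r 1) shape_weight d s) * l1norm 1 (root_contrast R i j)
  <= e.
Proof.
(* The threshold, twice the weight above it and twice the missing weight add up
   to e. *)
move=> e0; have e5 : 0 < e / 5 by rewrite divr_gt0.
have [r hr] := rare_reconstruction e5.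
have e5' : 1 - e / 5 < 1 by rewrite gtrBl.
have /cvgr_ge/(_ _ e5') hK := cvg_sum_shapes hGW r.
near \oo => K; exists r, K.
have W1 : 1 - e / 5 <= \sum_(s <- shapes K r 1) shape_weight d s by near: K.
have W2 : \sum_(s <- shapes K r 1) shape_weight d s <= 1 by exact: sum_shape_weight_le1.
have w0 s : 0 <= shape_weight d s.
  by apply: prodr_ge0 => kap _; apply: prodr_ge0 => t _; exact: poisson_pmf_ge0.
have big : \sum_(s <- shapes K r 1 | e / 5 < N s) shape_weight d s <= e / 5.
  rewrite -lee_fin (sum_shapes_prob hGW).
  apply: le_trans hr; rewrite le_measure ?inE //.
  - exact: (measurable_countable_preimage (fun s => s \in _) (measurable_shape xi r)).
  - exact: (measurable_N r (fun x => e / 5 < x)).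
  - by move=> w /=; rewrite mem_filter => /andP[].
have main : \sum_(s <- shapes K r 1) shape_weight d s * N s <= e / 5 + 2 * (e / 5).
  rewrite (bigID (fun s => e / 5 < N s)) /= addrC; apply: lerD.
    apply: (@le_trans _ _ (\sum_(s <- shapes K r 1 | ~~ (e / 5 < N s))
       shape_weight d s * (e / 5))).
      apply: ler_sum => s; rewrite -leNgt => h; exact: ler_wpM2l.
    rewrite -mulr_suml ler_piMl ?(ltW e5) //; apply: le_trans W2.
    rewrite [leRHS](bigID (fun s => e / 5 < N s)) /= lerDr.
    exact: sumr_ge0.
  apply: (@le_trans _ _ (\sum_(s <- shapes K r 1 | e / 5 < N s) shape_weight d s * 2)).
    rewrite big_seq_cond [leRHS]big_seq_cond; apply: ler_sum => s /andP[].
    rewrite mem_shapes => /and3P[_ vs _] _; apply: ler_wpM2l => //.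
    by apply: le_trans (shape_norm_le _ M_ge0 M_sum vs) _; exact: l1norm_root_contrast.
  by rewrite -mulr_suml mulrC ler_wpM2l.
have L2 := l1norm_root_contrast.
have L0 : 0 <= l1norm 1 (root_contrast R i j) by exact: sumr_ge0.
move: (\sum_(s <- _) _) main => S1 main.
move: (\sum_(s <- _) _) W1 W2 => S2 W1 W2.
by move: (l1norm _ _) L0 L2 => L L0 L2; nra.
Unshelve. all: by end_near. Qed.

End NonreconstructionBound.

(** * The block model in terms of exposed rows *)

Section GraphSum.
Context (R : realFieldType) (A : finType) (p : A -> A -> R).

(** The probability of the edges of a graph given the labels [s] of the vertices
    k, k + 1, and so on, organised by rows. *)
Fixpoint rows_weight (adj : nat -> nat -> bool) (k : nat) (s : seq A) : R :=
  if s is x :: s' then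
    row_weight p x [seq adj k l | l <- iota k.+1 (size s')] s' *
    rows_weight adj k.+1 s'
  else 1.

(** Grouping the graphs by their first row reproduces the recursion defining
    [graph_norm].  An inequality is enough below, so it need not be shown that
    all rows occur, only that the rows determine the graph. *)
Lemma sum_graphs_le (G : finType) (adj : G -> nat -> nat -> bool) (P : pred G)
    k m (F : seq A -> R) :
  (forall g g', P g -> P g' ->
     (forall i j, (k <= i)%N -> (i < j)%N -> (j < k + m)%N -> adj g i j = adj g' i j) ->
     g = g') ->
  \sum_(g | P g) `|\sum_(s : m.-tuple A) F s * rows_weight (adj g) k s|
  <= graph_norm p m F.
Proof.
elim: m k P F => [|m IH] k P F inj.
  case: (pickP P) => [g Pg|P0]; last by rewrite big_pred0 //= normr_ge0.
  rewrite (bigD1 g) //= [X in _ + X]big1 ?addr0 => [|g' /andP[Pg' /eqP g'g]].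
    by rewrite (sum_tuple0 (fun s => F s * rows_weight (adj g) k s)) /= mulr1.
  case: g'g; apply: inj => // i j ki ij; rewrite addn0 => jk.
  by have := leq_ltn_trans ki (ltn_trans ij jk); rewrite ltnn.
pose row g : m.-tuple bool := [tuple of [seq adj g k l | l <- iota_tuple m k.+1]].
rewrite (partition_big row xpredT) //=; apply: ler_sum => b _.
apply: le_trans (IH k.+1 (fun g => P g && (row g == b)) (peel_root p F b) _).
  rewrite le_eqVlt; apply/orP; left; apply/eqP.
  apply: eq_bigr => g /andP[_ /eqP <-]; congr `|_|.
  rewrite (sum_tuple_cons (fun s => F s * rows_weight (adj g) k s)) exchange_big.
  apply: eq_bigr => s _; rewrite /peel_root mulr_suml; apply: eq_bigr => l _ /=.
  by rewrite size_tuple mulrA.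
move=> g g' /andP[Pg /eqP gb] /andP[Pg' /eqP g'b] h; apply: inj => // i j ki ij jk.
move: ki; rewrite leq_eqVlt => /orP[/eqP ik|ki]; last by apply: h => //; lia.
have := congr1 (fun t : m.-tuple bool => nth false t (j - k.+1)) (etrans gb (esym g'b)).
rewrite /= !(nth_map 0%N) ?size_iota ?nth_iota; try lia.
have kj : (k < j)%N by rewrite ik.
by rewrite subnKC // ik.
Qed.

Lemma row_weight_nth (x0 : A) l b s : size b = size s ->
  row_weight p l b s =
  \prod_(k < size s) edge_weight p l (nth x0 s k) (nth false b k).
Proof.
move=> sz; rewrite /row_weight (big_nth (false, x0)) size_zip sz minnn big_mkord.
by apply: eq_bigr => k _; rewrite nth_zip.
Qed.

Lemma rows_weightE (x0 : A) adj k s :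
  rows_weight adj k s = \prod_(i < size s) \prod_(j < size s | (i < j)%N)
    edge_weight p (nth x0 s i) (nth x0 s j) (adj (k + i)%N (k + j)%N).
Proof.
elim: s k => [|x s IH] k; first by rewrite /= big_ord0.
rewrite [RHS]big_ord_recl /= (row_weight_nth x0) ?size_map ?size_iota //.
congr (_ * _).
  rewrite [RHS]big_mkcond big_ord_recl /= mul1r; apply: eq_bigr => j _ /=.
  by rewrite (nth_map 0%N) ?size_iota // nth_iota // addn0 addSnnS.
rewrite IH; apply: eq_bigr => i _.
rewrite [RHS]big_mkcond big_ord_recl /= mul1r [LHS]big_mkcond.
by apply: eq_bigr => j _; rewrite /= /bump /= !add1n ltnS !addnS.
Qed.

End GraphSum.

Section BlockModel.
Context (R : realType) (n q : nat) (pin pout : R).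

Local Notation p := (fun l x : 'I_q => if l == x then pin else pout).

Definition graph_adj (G : simple_graph n) (i j : nat) : bool :=
  [exists e : 'I_n * 'I_n, [&& e \in val G, val e.1 == i & val e.2 == j]].

Lemma graph_adj_ord (G : simple_graph n) (u v : 'I_n) :
  graph_adj G u v = ((u, v) \in val G).
Proof.
apply/existsP/idP => [[[u' v'] /and3P[h /eqP/val_inj/= <- /eqP/val_inj/= <-]]//|h].
by exists (u, v); rewrite h !eqxx.
Qed.

Lemma graph_adj_inj (G G' : simple_graph n) :
  (forall i j, (0 <= i)%N -> (i < j)%N -> (j < 0 + n)%N ->
     graph_adj G i j = graph_adj G' i j) -> G = G'.
Proof.
move=> h; apply: val_inj; apply/setP => -[u v].
have /andP[/forallP Girr /forallP Gsym] := valP G.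
have /andP[/forallP Girr' /forallP Gsym'] := valP G'.
have symG x y : ((x, y) \in val G) = ((y, x) \in val G).
  by have /forallP/(_ y)/eqP := Gsym x.
have symG' x y : ((x, y) \in val G') = ((y, x) \in val G').
  by have /forallP/(_ y)/eqP := Gsym' x.
have lt (x y : 'I_n) : (x < y)%N -> ((x, y) \in val G) = ((x, y) \in val G').
  by move=> xy; rewrite -!graph_adj_ord h.
case: (ltngtP u v) => [|uv|/val_inj ->]; first exact: lt.
  by rewrite symG symG' lt.
by rewrite (negbTE (Girr v)) (negbTE (Girr' v)).
Qed.

Lemma sum_labelling (V : nmodType) (H : labelling n q -> V) :
  \sum_(s : labelling n q) H s =
  \sum_(t : n.-tuple 'I_q) H [ffun u => tnth t u].
Proof.
rewrite (reindex (fun t : n.-tuple 'I_q => [ffun u => tnth t u])) //=.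
exists (fun s : labelling n q => [tuple s u | u < n]).
  by move=> t _; apply: eq_from_tnth => u; rewrite tnth_mktuple ffunE.
by move=> s _; apply/ffunP => u; rewrite ffunE tnth_mktuple.
Qed.

Lemma sbm_pmfE (t : n.-tuple 'I_q) (G : simple_graph n) :
  sbm_pmf pin pout [ffun u => tnth t u] G =
  (q%:R ^+ n)^-1 * rows_weight p (graph_adj G) 0 t.
Proof.
congr (_ * _).
case: (pickP (@predT 'I_n)) => [u0 _|no]; last first.
  have /size0nil -> : size t = 0%N.
    by rewrite size_tuple -[n]card_ord; exact: eq_card0.
  by rewrite big_pred0 // => -[u v]; have := no u.
rewrite (rows_weightE p (tnth t u0)) size_tuple pair_big_dep /=.
apply: eq_bigr => -[u v] _ /=.
rewrite !add0n graph_adj_ord /edge_weight /edge_prob !ffunE.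
by rewrite -!tnth_nth.
Qed.

Lemma sum_sbm_le (f : labelling n q -> R) (F : seq 'I_q -> R) :
  (forall t : n.-tuple 'I_q, F t = (q%:R ^+ n)^-1 * f [ffun u => tnth t u]) ->
  \sum_(G : simple_graph n) `|\sum_(s : labelling n q) sbm_pmf pin pout s G * f s|
  <= graph_norm p n F.
Proof.
move=> FE.
apply: le_trans (@sum_graphs_le R _ p _ graph_adj xpredT 0 n F _).
  rewrite le_eqVlt; apply/orP; left; apply/eqP; apply: eq_bigr => G _.
  rewrite sum_labelling; congr `|_|; apply: eq_bigr => t _.
  by rewrite sbm_pmfE FE; ring.
by move=> G G' _ _; exact: graph_adj_inj.
Qed.

End BlockModel.

(** * From decaying correlations to the failure of estimators *)

Section Detection.
Context (R : realType) (q : nat) (a b d lam : R).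
Hypothesis hq : (2 <= q)%N.
Hypothesis ha : 0 < a.
Hypothesis hb : 0 < b.
Hypothesis hd : d = (a + (q%:R - 1) * b) / q%:R.
Hypothesis hlam : lam = (a - b) / (a + (q%:R - 1) * b).

Local Notation M := (@transition R q lam).
Let q_gt0 : 0 < q%:R :> R.
Proof. by rewrite ltr0n (leq_trans _ hq). Qed.
Let q_ge1 : 1 <= q%:R :> R.
Proof. by rewrite ler1n (leq_trans _ hq). Qed.
Let D_gt0 : 0 < a + (q%:R - 1) * b.
Proof. by rewrite ltr_wpDr // mulr_ge0 ?(ltW hb) // subr_ge0. Qed.

Let sum_pairs (x : R) : \sum_(i : 'I_q) \sum_(j : 'I_q) x = q%:R ^+ 2 * x.
Proof.
by rewrite !sumr_const card_ord -mulrnA -[LHS]mulr_natl natrM.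
Qed.

Lemma mean_degree_gt0 : 0 < d.
Proof. by rewrite hd divr_gt0. Qed.

(** The relation between the parameters of the block model and those of the
    broadcast process: the edge probabilities are a multiple of the broadcast
    kernel. *)
Lemma scaled_transition l x : d * q%:R * M l x = if l == x then a else b.
Proof.
rewrite /transition hlam hd; case: eqP => _; field.
  by rewrite !gt_eqF.
by rewrite !gt_eqF.
Qed.

Lemma transition_ge0 l x : 0 <= M l x.
Proof.
have := scaled_transition l x; have dq : 0 < d * q%:R by rewrite mulr_gt0 ?mean_degree_gt0.
rewrite -(pmulr_rge0 _ dq) => ->; case: ifP => _; exact: ltW.
Qed.

Lemma transition_sum l : \sum_x M l x = 1.
Proof.
rewrite (bigD1 l) //= (eq_bigr (fun=> (1 - lam) / q%:R)); last first.
  by move=> x /negPf xl; rewrite /transition eq_sym xl.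
rewrite sumr_const /transition eqxx.
have -> : #|[pred x | x != l]| = q.-1 by rewrite cardC1 card_ord.
rewrite -[_ *+ q.-1]mulr_natr.
have -> : q.-1%:R = q%:R - 1 :> R by rewrite -subn1 natrB // (leq_trans _ hq).
by field; rewrite gt_eqF.
Qed.

Lemma transition_sym l x : M l x = M x l.
Proof. by rewrite /transition eq_sym. Qed.

Lemma sparse_edgeE n l x :
  sparse_edge M d n l x = if l == x then a / n%:R else b / n%:R.
Proof.
rewrite /sparse_edge /kernel_edge card_ord.
have -> : d / n%:R * q%:R * M l x = d * q%:R * M l x / n%:R by ring.
by rewrite scaled_transition; case: ifP.
Qed.

(** In the graph, together with the label [lv] of one vertex, there is
    asymptotically no information on whether another vertex has label [i] or
    [j]. *)
Definition correlations_vanish : Prop := forall (i j lv : 'I_q) (e : R), 0 < e ->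
  \forall n \near \oo, graph_norm (sparse_edge M d n) n
    (padded 2 (n - 2) (witness lv (root_contrast R i j))) <= e.

Definition sparse_sbm n (s : labelling n q) (G : simple_graph n) : R :=
  sbm_pmf (a / n%:R) (b / n%:R) s G.

Let psym n l x : sparse_edge M d n l x = sparse_edge M d n x l.
Proof. by rewrite /sparse_edge /kernel_edge transition_sym. Qed.

Lemma sum_sbm_le_sparse n (f : labelling n q -> R) (F : seq 'I_q -> R) :
  (forall t : n.-tuple 'I_q, F t = (q%:R ^+ n)^-1 * f [ffun u => tnth t u]) ->
  \sum_(G : simple_graph n) `|\sum_(s : labelling n q) sparse_sbm s G * f s|
  <= graph_norm (sparse_edge M d n) n F.
Proof.
move=> FE.
have -> : sparse_edge M d n = fun l x => if l == x then a / n%:R else b / n%:R.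
  by apply/funext => l; apply/funext => x; exact: sparse_edgeE.
exact: sum_sbm_le.
Qed.

(** The two vertices become the distinguished ones.  The weight q^-2 of their
    uniform labels is bounded by 1. *)
Lemma pair_correlation n (u v : 'I_n) i j lv : u != v ->
  \sum_(G : simple_graph n) `|\sum_(s : labelling n q)
     sparse_sbm s G * (root_contrast R i j [:: s u] * (s v == lv)%:R)| <=
  graph_norm (sparse_edge M d n) n
    (padded 2 (n - 2) (witness lv (root_contrast R i j))).
Proof.
move=> uv.
pose F (t : seq 'I_q) := (q%:R ^+ n)^-1 *
  (root_contrast R i j [:: nth lv t u] * (nth lv t v == lv)%:R).
apply: le_trans (sum_sbm_le_sparse (F := F) _) _.
  by move=> t; rewrite /F !ffunE -!tnth_nth.
have uv' : (u : nat) != v by [].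
have [ks Hks] := front2_swaps uv' (ltn_ord u) (ltn_ord v).
have n2 : (2 <= n)%N.
  by have := ltn_ord u; have := ltn_ord v; move/eqP: uv' => ? ? ?; lia.
rewrite -(graph_norm_swaps (@psym n) n ks (padded 2 (n - 2) _)).
rewrite (@eq_graph_norm _ _ _ _ _ (fun s => q%:R ^- 2 *
   padded 2 (n - 2) (witness lv (root_contrast R i j)) (swaps ks s))); last first.
  move=> t tn; rewrite /F /padded (Hks _ lv) //= card_ord.
  have -> : q%:R ^+ n = q%:R ^+ 2 * q%:R ^+ (n - 2) :> R by rewrite -exprD subnKC.
  by rewrite invfM exprVn; ring.
rewrite graph_normZ ler_piMl ?graph_norm_ge0 // ger0_norm ?invr_ge0 ?exprn_ge0 ?ler0n //.
by rewrite invf_le1 ?exprn_gt0 // exprn_ege1.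
Qed.

Definition centered (j x : 'I_q) : R := (x == j)%:R - q%:R^-1.

Lemma centered_le1 j x : `|centered j x| <= 1.
Proof.
have h : 0 <= (q%:R^-1 : R) <= 1 by rewrite invr_ge0 ler0n /= invf_le1.
by rewrite /centered ler_norml; case: (x == j) => /=; lra.
Qed.

(** Deviation from the uniform law as an average of contrasts of two labels. *)
Lemma centeredE j x : centered j x = \sum_i q%:R^-1 * root_contrast R j i [:: x].
Proof.
rewrite -mulr_sumr /root_contrast sumrB sumr_const card_ord mulrBr.
rewrite -[point_mass _ _ _ *+ q]mulr_natl mulKf ?gt_eqF // /centered /point_mass.
congr (_ - _); first by rewrite eqseq_cons eqxx andbT.
rewrite (bigD1 x) //= eqxx big1 ?addr0 ?mulr1 // => i /negPf ix.
by rewrite eqseq_cons eq_sym ix.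
Qed.

Lemma centered_correlation n (u v : 'I_n) j (e : R) : u != v ->
  (forall i lv, graph_norm (sparse_edge M d n) n
    (padded 2 (n - 2) (witness lv (root_contrast R j i))) <= e) ->
  \sum_(G : simple_graph n) `|\sum_(s : labelling n q)
     sparse_sbm s G * (centered j (s u) * centered j (s v))| <= q%:R * e.
Proof.
move=> uv he.
have -> : q%:R * e = \sum_(i : 'I_q) \sum_(lv : 'I_q) q%:R^-1 * e.
  by rewrite sum_pairs expr2 -mulrA mulVKf // gt_eqF.
apply: (@le_trans _ _ (\sum_(i : 'I_q) \sum_(lv : 'I_q) q%:R^-1 * `|centered j lv| *
  \sum_(G : simple_graph n) `|\sum_(s : labelling n q)
     sparse_sbm s G * (root_contrast R j i [:: s u] * (s v == lv)%:R)|)); last first.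
  apply: ler_sum => i _; apply: ler_sum => lv _; rewrite -mulrA ler_wpM2l ?invr_ge0 ?ler0n //.
  apply: le_trans (le_trans (pair_correlation _ _ _ uv) (he i lv)).
  by rewrite ler_piMl ?sumr_ge0 // centered_le1.
under [leRHS]eq_bigr => i _ do under eq_bigr => lv _ do rewrite mulr_sumr.
under [leRHS]eq_bigr => i _ do rewrite exchange_big /=.
rewrite [leRHS]exchange_big /=; apply: ler_sum => G _.
have -> : \sum_(s : labelling n q) sparse_sbm s G * (centered j (s u) * centered j (s v)) =
  \sum_i \sum_lv q%:R^-1 * centered j lv * \sum_(s : labelling n q)
     sparse_sbm s G * (root_contrast R j i [:: s u] * (s v == lv)%:R).
  under [RHS]eq_bigr => i _ do under eq_bigr => lv _ do rewrite mulr_sumr.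
  under [RHS]eq_bigr => i _ do rewrite exchange_big /=.
  rewrite [RHS]exchange_big /=; apply: eq_bigr => s _.
  rewrite [centered j (s u)]centeredE mulr_suml mulr_sumr; apply: eq_bigr => i _.
  rewrite (bigD1 (s v)) //= eqxx big1 ?addr0; first by rewrite mulr1; ring.
  by move=> lv /negPf lvs; rewrite eq_sym lvs !mulr0.
apply: le_trans (ler_norm_sum _ _ _) _; apply: ler_sum => i _.
apply: le_trans (ler_norm_sum _ _ _) _; apply: ler_sum => lv _.
by rewrite 2!normrM [`|_^-1|]ger0_norm // invr_ge0.
Qed.

(** The number of vertices with estimate [i] and label [j], minus its value for
    labels that are uniform and independent of the estimate. *)
Definition overlap n (i j : 'I_q) (shat s : labelling n q) : R :=
  \sum_(u < n) (shat u == i)%:R * centered j (s u).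

(** If all overlaps vanish, then each permutation of the labels yields exactly
    n / q agreements; this is why the maximum over permutations does not help. *)
Lemma agreement_le n (shat s : labelling n q) :
  (agreement shat s)%:R <= n%:R / q%:R + \sum_j \sum_i `|overlap i j shat s|.
Proof.
rewrite /agreement.
have [|g ->] := @bigop.eq_bigmax 'S_q (fun g => #|[set u | shat u == g (s u)]%SET|).
  by apply/card_gt0P; exists 1%g.
have -> : #|[set u | shat u == g (s u)]%SET|%:R =
   \sum_j \sum_(u < n) (shat u == g j)%:R * (centered j (s u) + q%:R^-1) :> R.
  rewrite exchange_big -sum1dep_card natr_sum big_mkcond; apply: eq_bigr => u _ /=.
  rewrite (bigD1 (s u)) //= /centered eqxx subrK mulr1 big1 ?addr0; first by case: ifP.
  by move=> j /negPf js; rewrite [s u == j]eq_sym js subrK mulr0.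
have -> : \sum_j \sum_(u < n) (shat u == g j)%:R * (centered j (s u) + q%:R^-1) =
   n%:R / q%:R + \sum_j overlap (g j) j shat s.
  have -> : n%:R / q%:R = \sum_j \sum_(u < n) (shat u == g j)%:R * q%:R^-1 :> R.
    rewrite exchange_big /=; under [RHS]eq_bigr => u _.
      rewrite -mulr_suml (bigD1 (g^-1%g (shat u))) //= permKV eqxx big1 ?addr0; last first.
        move=> j ju; case: eqP => // e; move: ju.
        by rewrite e permK eqxx.
      rewrite mul1r; over.
    by rewrite sumr_const card_ord -[RHS]mulr_natl.
  rewrite -big_split; apply: eq_bigr => j _; rewrite /overlap -big_split /=.
  by apply: eq_bigr => u _; rewrite mulrDr addrC.
rewrite lerD2l; apply: ler_sum => j _; apply: le_trans (ler_norm _) _.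
by rewrite (bigD1 (g j)) //= lerDl sumr_ge0.
Qed.

Section LargeGraph.
Variables (n : nat) (e : R).
Hypothesis p01 : forall l x, 0 <= sparse_edge M d n l x <= 1.
Hypothesis hcor : forall i j lv, graph_norm (sparse_edge M d n) n
    (padded 2 (n - 2) (witness lv (root_contrast R i j))) <= e.

Local Notation E := (@sbm_expectation R n q (a / n%:R) (b / n%:R)).

Lemma sparse_sbm_ge0 s G : 0 <= sparse_sbm (n := n) s G.
Proof.
rewrite /sparse_sbm /sbm_pmf mulr_ge0 ?invr_ge0 ?exprn_ge0 ?ler0n //.
apply: prodr_ge0 => uv _.
have := p01 (s uv.1) (s uv.2); rewrite sparse_edgeE /edge_prob.
by case: ifP => _ /andP[h h']; case: ifP => _ //; rewrite subr_ge0.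
Qed.

Lemma expectation_le f g : (forall s G, f s G <= g s G) -> E f <= E g.
Proof.
move=> fg; apply: ler_sum => s _; apply: ler_sum => G _.
by apply: ler_wpM2l; [exact: sparse_sbm_ge0 | exact: fg].
Qed.

Lemma expectation1_le : E (fun _ _ => 1) <= 1.
Proof.
rewrite /sbm_expectation exchange_big /=.
apply: (@le_trans _ _ (\sum_(G : simple_graph n)
    `|\sum_(s : labelling n q) sparse_sbm s G * (fun=> 1) s|)).
  by apply: ler_sum => G _; exact: ler_norm.
apply: le_trans (sum_sbm_le_sparse (F := fun=> (q%:R ^+ n)^-1) _) _.
  by move=> t; rewrite mulr1.
apply: le_trans (graph_norm_le_l1 p01 _ _) _.
rewrite sum_tuple_const card_ord ger0_norm ?invr_ge0 ?exprn_ge0 ?ler0n //.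
by rewrite mulfV // expf_neq0 // gt_eqF.
Qed.

(** Given the graph, the estimate is deterministic, so only the conditional
    correlations of the labels of two vertices enter.  The diagonal contributes
    at most n. *)
Lemma overlap_second_moment est i j : 0 <= e ->
  E (fun s G => overlap i j (est G) s ^+ 2) <= n%:R + n%:R ^+ 2 * (q%:R * e).
Proof.
move=> e0; rewrite /sbm_expectation exchange_big /=.
pose C (u v : 'I_n) := \sum_(G : simple_graph n) `|\sum_(s : labelling n q)
     sparse_sbm s G * (centered j (s u) * centered j (s v))|.
apply: (@le_trans _ _ (\sum_(u < n) \sum_(v < n) C u v)).
  rewrite /C; under [leRHS]eq_bigr => u _ do rewrite exchange_big /=.
  rewrite [leRHS]exchange_big /=; apply: ler_sum => G _.
  have -> : \sum_(s : labelling n q) sbm_pmf (a / n%:R) (b / n%:R) s G *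
      overlap i j (est G) s ^+ 2 =
    \sum_(u < n) \sum_(v < n) ((est G u == i)%:R * (est G v == i)%:R) *
      \sum_(s : labelling n q) sparse_sbm s G * (centered j (s u) * centered j (s v)).
    under [RHS]eq_bigr => u _ do under eq_bigr => v _ do rewrite mulr_sumr.
    under [RHS]eq_bigr => u _ do rewrite exchange_big /=.
    rewrite [RHS]exchange_big /=; apply: eq_bigr => s _.
    rewrite expr2 /overlap mulr_suml mulr_sumr; apply: eq_bigr => u _.
    rewrite mulr_sumr mulr_sumr; apply: eq_bigr => v _; rewrite /sparse_sbm; ring.
  apply: ler_sum => u _; apply: ler_sum => v _.
  apply: le_trans (ler_norm _) _; rewrite normrM ler_piMl //.
  by case: eqP => _; case: eqP => _; rewrite ?(mul0r, mulr0, mulr1, normr0, normr1).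
have diag u : C u u <= 1.
  apply: le_trans expectation1_le; rewrite /sbm_expectation exchange_big /=.
  apply: ler_sum => G _; apply: le_trans (ler_norm_sum _ _ _) _.
  apply: ler_sum => s _; rewrite normrM ger0_norm ?sparse_sbm_ge0 // ler_wpM2l ?sparse_sbm_ge0 //.
  by rewrite normrM mulr_ile1 ?centered_le1.
have off u v : u != v -> C u v <= q%:R * e.
  by move=> uv; apply: centered_correlation.
apply: (@le_trans _ _ (\sum_(u < n) (1 + n%:R * (q%:R * e)))).
  apply: ler_sum => u _; rewrite (bigD1 u) //=; apply: lerD => //.
  apply: (@le_trans _ _ (\sum_(v < n | v != u) q%:R * e)).
    by apply: ler_sum => v vu; apply: off; rewrite eq_sym.
  apply: (@le_trans _ _ (\sum_(v < n) q%:R * e)).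
    rewrite [leRHS](bigID (fun v => v != u)) /= lerDl.
    by apply: sumr_ge0 => v _; rewrite mulr_ge0 ?ler0n.
  by rewrite sumr_const card_ord -[leLHS]mulr_natl.
by rewrite sumr_const card_ord -[leLHS]mulr_natl; lra.
Qed.

Lemma expected_agreement_le est delta : 0 <= e -> 0 < delta -> (0 < n)%N ->
  n%:R^-1 * E (fun s G => (agreement (est G) s)%:R) <=
  q%:R^-1 + q%:R ^+ 2 * (delta + (n%:R^-1 + q%:R * e) / delta).
Proof.
move=> e0 del0 n0; have n0' : 0 < n%:R :> R by rewrite ltr0n.
rewrite mulrC ler_pdivrMr //.
pose bnd : R := n%:R / q%:R + q%:R ^+ 2 * (n%:R * delta).
have nd0 : 0 < n%:R * delta by rewrite mulr_gt0.
apply: (@le_trans _ _ (E (fun s G => bnd * 1 +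
    \sum_j \sum_i (n%:R * delta)^-1 * overlap i j (est G) s ^+ 2))).
  apply: expectation_le => s G; apply: le_trans (agreement_le _ _) _.
  rewrite mulr1 /bnd -addrA lerD2l.
  rewrite -sum_pairs.
  rewrite -big_split; apply: ler_sum => j _; rewrite -big_split; apply: ler_sum => i _ /=.
  by apply: le_trans (norm_le_sqr _ nd0) _; rewrite [_^-1 * _]mulrC.
have -> : E (fun s G => bnd * 1 +
    \sum_j \sum_i (n%:R * delta)^-1 * overlap i j (est G) s ^+ 2) =
  bnd * E (fun _ _ => 1) + \sum_j \sum_i (n%:R * delta)^-1 *
    E (fun s G => overlap i j (est G) s ^+ 2).
  rewrite /sbm_expectation mulr_sumr.
  under [X in _ = _ + X]eq_bigr => j _ do under eq_bigr => i _ do rewrite mulr_sumr.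
  under [X in _ = _ + X]eq_bigr => j _ do rewrite exchange_big /=.
  rewrite [X in _ = _ + X]exchange_big -big_split; apply: eq_bigr => s _ /=.
  rewrite mulr_sumr.
  under [X in _ = _ + X]eq_bigr => j _ do under eq_bigr => i _ do rewrite mulr_sumr.
  under [X in _ = _ + X]eq_bigr => j _ do rewrite exchange_big /=.
  rewrite [X in _ = _ + X]exchange_big -big_split; apply: eq_bigr => G _ /=.
  rewrite mulrDr; congr (_ + _); first by ring.
  rewrite mulr_sumr; apply: eq_bigr => j _; rewrite mulr_sumr.
  by apply: eq_bigr => i _; ring.
have bnd0 : 0 <= bnd by rewrite /bnd addr_ge0 ?mulr_ge0 ?divr_ge0 ?ler0n ?(ltW del0).
have -> : (q%:R^-1 + q%:R ^+ 2 * (delta + (n%:R^-1 + q%:R * e) / delta)) * n%:R =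
   bnd + \sum_(j : 'I_q) \sum_(i : 'I_q) (n%:R * delta)^-1 * (n%:R + n%:R ^+ 2 * (q%:R * e)).
  rewrite sum_pairs /bnd.
  by field; rewrite !gt_eqF.
apply: lerD.
  by rewrite ler_piMr // expectation1_le.
apply: ler_sum => j _; apply: ler_sum => i _; apply: ler_wpM2l.
  by rewrite invr_ge0 mulr_ge0 ?ler0n ?ltW.
exact: overlap_second_moment.
Qed.

End LargeGraph.

End Detection.

(** * Nonreconstruction makes detection impossible *)

Lemma limn_esup_le_near (R : realType) (u : (\bar R)^nat) (x : \bar R) :
  (\forall n \near \oo, (u n <= x)%E) -> (limn_esup u <= x)%E.
Proof.
move=> [m _ hm]; rewrite limn_esup_lim; apply: lime_le; first exact: is_cvg_esups.
exists m => // n /= mn; apply: ge_ereal_sup => _ [k /= nk <-].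
by apply: hm; exact: leq_trans mn nk.
Qed.

(** The exploration starts with two distinguished vertices, the witness and the
    root, hence with n - 2 fresh vertices. *)
Lemma nonreconstruction_correlations_vanish (R : realType) (q : nat) (a b d lam : R)
    (disp : measure_display) (Omega : measurableType disp)
    (P : probability Omega R) (xi : seq nat -> {RV P >-> nat}) :
  (2 <= q)%N -> 0 < a -> 0 < b ->
  d = (a + (q%:R - 1) * b) / q%:R ->
  lam = (a - b) / (a + (q%:R - 1) * b) ->
  poisson_galton_watson d xi ->
  {ae P, forall w, nonreconstruction q lam (fun u => xi u w)} ->
  correlations_vanish q d lam.
Proof.
move=> hq ha hb hd hlam hGW hnonrec i j lv e e0.
have d0 := mean_degree_gt0 hq ha hb hd.
have M0 := transition_ge0 hq ha hb hd hlam.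
have M1 := transition_sum lam hq.
have A0 : (0 < #|'I_q|)%N by rewrite card_ord (leq_trans _ hq).
have e2 : 0 < e / 2 by rewrite divr_gt0.
have [r [K hrK]] := shapes_bound hGW d0 M0 M1 hnonrec i j e2.
have Msym := @transition_sym R q lam.
have := asym_le_mono hrK (asym_wit_shapes A0 M0 M1 Msym d0 lv K r 1 (root_contrast R i j)).
move=> /(_ 2%N _ e2) h; near=> n.
have n2 : (2 <= n)%N by near: n; exact: nbhs_infty_ge.
have -> : e = e / 2 + e / 2 by field.
rewrite -[X in graph_norm _ X](subnKC n2).
by near: n.
Unshelve. all: by end_near. Qed.

Theorem theorem2p1 (R : realType) (q : nat) (a b d lam : R)
    (disp : measure_display) (Omega : measurableType disp)
    (P : probability Omega R) (xi : seq nat -> {RV P >-> nat})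
    (hq : (2 <= q)%N) (ha : 0 < a) (hb : 0 < b)
    (hd : d = (a + (q%:R - 1) * b) / q%:R)
    (hlam : lam = (a - b) / (a + (q%:R - 1) * b))
    (hGW : poisson_galton_watson d xi)
    (hnonrec : {ae P, forall w, nonreconstruction q lam (fun u => xi u w)}) :
  ~ detection_possible q a b.
Proof.
have decay := nonreconstruction_correlations_vanish hq ha hb hd hlam hGW hnonrec.
have d0 := mean_degree_gt0 hq ha hb hd.
have M0 := transition_ge0 hq ha hb hd hlam.
have M1 := transition_sum lam hq.
have A0 : (0 < #|'I_q|)%N by rewrite card_ord (leq_trans _ hq).
move=> [eps [est [eps0 hdet]]].
have q0 : 0 < q%:R :> R by rewrite ltr0n (leq_trans _ hq).
(* The bound of [expected_agreement_le] has three error terms, each of which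
   becomes at most q^2 delta = eps / 4. *)
pose delta := eps / 4 / q%:R ^+ 2.
have del0 : 0 < delta by rewrite !divr_gt0 ?exprn_gt0.
pose e := delta ^+ 2 / q%:R.
have e0 : 0 < e by rewrite divr_gt0 ?exprn_gt0.
suff : (limn_esup (fun n : nat => (n%:R^-1 * sbm_expectation (a / n%:R) (b / n%:R)
   (fun s G => (agreement (est n G) s)%:R : R))%:E) <= (q%:R^-1 + eps * (3 / 4))%:E)%E.
  move=> /(le_trans hdet); rewrite lee_fin lerD2l => h.
  by move: h; rewrite ler_pMr //; lra.
apply: limn_esup_le_near; near=> n.
have n0 : (0 < n)%N by near: n; exact: nbhs_infty_ge.
have p01 : forall l x, 0 <= sparse_edge (@transition R q lam) d n l x <= 1.
  by near: n; exact: sparse_edge01.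
have hcor : forall i j lv, graph_norm (sparse_edge (@transition R q lam) d n) n
    (padded 2 (n - 2) (witness lv (root_contrast R i j))) <= e.
  near: n; apply: filter_forall => i; apply: filter_forall => j.
  by apply: filter_forall => lv; exact: decay.
have nd : delta ^- 2 < n%:R by near: n; exact: nbhs_infty_gtr.
rewrite lee_fin.
apply: le_trans (expected_agreement_le hq ha hb hd hlam p01 hcor (est n) (ltW e0) del0 n0) _.
rewrite lerD2l.
have n0' : 0 < n%:R :> R by rewrite ltr0n.
have ninv : n%:R^-1 <= delta ^+ 2.
  by rewrite -[leRHS]invrK lef_pV2 ?posrE ?invr_gt0 ?exprn_gt0 // ltW.
have -> : q%:R * e = delta ^+ 2 by rewrite /e mulrC mulfVK // gt_eqF.
have h : (n%:R^-1 + delta ^+ 2) / delta <= 2 * delta.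
  by rewrite ler_pdivrMr //; lra.
have -> : eps * (3 / 4) = q%:R ^+ 2 * (3 * delta).
  by rewrite /delta; field; rewrite gt_eqF.
by rewrite ler_wpM2l ?exprn_ge0 ?ler0n //; lra.
Unshelve. all: by end_near. Qed.
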